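(* Let $k$ be a CM field, $p$ a prime, and fix an embedding $k\subset\mathbb{C}$. Let $\xi\in E_p(k)$ and let $H$ be an abelian subgroup of $\mathrm{Aut}\,k$ with $c\notin H$ such that the set $\{\xi^\sigma:\sigma\in H\}$ is a basis of $E_p(k)\otimes\mathbb{Q}$. Let $H_\xi=\{\sigma\in H:\sigma(\xi)=\xi\}$ and $\overline{H}=H/H_\xi$. For each $\overline{\sigma}\in\overline{H}$ choose a preimage $\sigma_v\in H$, view it (via $k\subset\mathbb{C}$) as an embedding $k\hookrightarrow\mathbb{C}$, and let $v$ be the infinite place it defines; $\sigma_v$ induces isomorphisms $k_v\cong\mathbb{C}$ and $\mathbb{R}(1)_v\cong\mathbb{R}(1):=i\mathbb{R}$. Let $S_\infty$ be the set of places so obtained. Let $s$ be any set-theoretic section of the projection $\mathbb{R}(1)\to\mathbb{R}(1)/\mathbb{Q}(1)$, where $\mathbb{Q}(1)=2\pi i\mathbb{Q}$, and put $s_v=\sigma_v^{-1}s\sigma_v$, a section of $\mathbb{R}(1)_v\to\mathbb{R}(1)_v/\mathbb{Q}(1)_v$. For each $\overline{\tau}\in\overline{H}$ let $\eta_{\overline{\tau}}\in V_k=\bigoplus_{v|\infty}\mathbb{R}(1)_v$ be a lift of $(\alpha_{p,\infty}\otimes1)(\overline{\tau}(\xi))=(\log_v(\overline{\tau}(\xi)_v))_{v|\infty}\in\bigoplus_{v|\infty}\mathbb{R}(1)_v/\mathbb{Q}(1)_v$ whose $v$-component for $v\in S_\infty$ is $s_v(\log_v(\overline{\tau}(\xi)_v))$,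 the other components being arbitrary lifts. Then the vectors $\eta_{\overline{\tau}}$, $\overline{\tau}\in\overline{H}$, are $\mathbb{R}$-linearly independent in $V_k$.
   Context: $E_p(k)$ is the group of $x\in k^*$ with $\|x\|_v=1$ for all places $v\nmid p$ of $k$ (including infinite places); $c$ is complex conjugation on the CM field $k$. All infinite places $v$ of $k$ are complex and $k_v\cong\mathbb{C}$; $\mathbb{R}(1)_v=\{z\in k_v:\mathrm{Re}\,z=0\}$, and for a subgroup $\Lambda\subset\mathbb{R}$, $\Lambda(1)_v$ is the image of $2\pi i\Lambda$ in $k_v$ under either continuous isomorphism $\mathbb{C}\cong k_v$. For $x\in E_p(k)$, $x_v$ denotes its image in $k_v$ (of absolute value one), and $\log_v(x_v)\in\mathbb{R}(1)_v/\mathbb{Z}(1)_v$ is its complex logarithm; $\alpha_{p,\infty}(x)=(\log_v x_v)_{v|\infty}$, and $\alpha_{p,\infty}\otimes1$ is its extension $E_p(k)\otimes\mathbb{Q}\to\bigoplus_{v|\infty}\mathbb{R}(1)_v/\mathbb{Q}(1)_v$. Here $\overline{\tau}(\xi)$ means $\tau(\xi)$ for any preimage $\tau\in H$ of $\overline{\tau}$. *)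

(* Defs.v *)
From HB Require Import structures.
From mathcomp Require Import all_boot all_order all_algebra all_field all_fingroup.
From mathcomp Require Import complex.
From mathcomp Require Import all_classical all_reals all_analysis Rstruct Rstruct_topology.

Set Implicit Arguments.
Unset Strict Implicit.
Unset Printing Implicit Defensive.

Import GRing.Theory Num.Theory.
Local Open Scope ring_scope.

Notation RR := Rdefinitions.R.
Notation CC := (RR[i]).

Definition totally_imaginary (k : fieldExtType rat) : Prop :=
  forall f : {rmorphism k -> CC}, exists x : k, f x \isn't Num.real.

Definition totally_real_subfield (k : fieldExtType rat) (K : {subfield k}) : Prop :=
  forall f : {rmorphism k -> CC}, forall x : k, x \in K -> f x \is Num.real.

Definition CM_field (k : fieldExtType rat) : Prop :=
  totally_imaginary k /\
  exists K : {subfield k},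
    (\dim {:k} = 2 * \dim K)%N /\ totally_real_subfield K.

Definition nonarch_abs (k : fieldExtType rat) (v : k -> RR) : Prop :=
  [/\ v 0 = 0,
      forall x, x != 0 -> 0 < v x,
      forall x y, v (x * y) = v x * v y,
      forall x y, v (x + y) <= Num.max (v x) (v y)
    & exists x, x != 0 /\ v x != 1].

(* E_p(k): x in k^* with |x|_v = 1 for every place v not dividing p:
   finite places (non-archimedean absolute values v with |p|_v = 1) and
   infinite places (given by complex embeddings). *)
Definition E_p (k : fieldExtType rat) (p : nat) (x : k) : Prop :=
  [/\ x != 0,
      forall v : k -> RR, nonarch_abs v -> v p%:R = 1 -> v x = 1
    & forall f : {rmorphism k -> CC}, `|f x| = 1].

(* x (x) 1 = 0 in E (x) Q, i.e. x is torsion. *)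
Definition torsion (k : fieldExtType rat) (x : k) : Prop :=
  exists N : nat, (0 < N)%N /\ x ^+ N = 1.

Definition basis_EpQ (k : fieldExtType rat) (p : nat) (I : finType)
  (A : {set I}) (y : I -> k) : Prop :=
  (* Q-linear independence of the y_t (x) 1 *)
  (forall n : I -> int,
      torsion (\prod_(t in A) y t ^ n t) -> forall t, t \in A -> n t = 0) /\
  (* the y_t (x) 1 span E_p(k) (x) Q *)
  (forall x : k, E_p p x ->
     exists m : nat, exists n : I -> int,
       (0 < m)%N /\ torsion (x ^+ m / \prod_(t in A) y t ^ n t)).

(* tbar(xi) := tau(xi) for any preimage tau in H of tbar in H / Hxi
   (here the canonical representative of the coset). *)
Definition bar_act (k : fieldExtType rat) (gT : finGroupType)
  (act : gT -> {rmorphism k -> k}) (Hxi : {group gT}) (t : coset_of Hxi)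
  (xi : k) : k := act (repr t) xi.

(* s is a set-theoretic section of R(1) -> R(1)/Q(1), in the coordinate
   R(1) = iR ~ R (i theta <-> theta), so Q(1) = 2 pi i Q <-> 2 pi Q. *)
Definition section_mod_2piQ (s : RR -> RR) : Prop :=
  (forall x, exists q : rat, s x = x + 2 * pi * ratr q) /\
  (forall x y (q : rat), x - y = 2 * pi * ratr q -> s x = s y).

(* Main.v *)
Require Import Defs.
From HB Require Import structures.
From mathcomp Require Import all_boot all_order all_algebra all_field all_fingroup.
From mathcomp Require Import complex.
From mathcomp Require Import all_classical all_reals all_analysis Rstruct Rstruct_topology.
From mathcomp Require Import zify ring lra.
Import Order.TTheory GRing.Theory Num.Theory.
Local Open Scope ring_scope.

Set Implicit Arguments.
Unset Strict Implicit.
Unset Printing Implicit Defensive.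

(** Let [G = H / Hxi] and let [a g] be the chosen logarithm (divided by [i]) of
    [iota (g xi)].  At the place of [v] the coordinate of [eta t] is [a (v t)], so
    the matrix of the [eta t] at the places of [S_oo] is the group matrix
    [a (v t)], and it must be shown that no character sum [sum a(g) d(g)]
    vanishes.  The [a g] are Q-linearly independent, and this is an instance of
    Baker's theorem, obtained in the way of Bertrand and Masser from a
    Schneider-Lang argument in several variables.

    If some character sum vanishes, the row space [V] of the group matrix is
    spanned by fewer than [#|G|] characters, hence has a basis of algebraic
    vectors.  The [#|G|] exponentials [z |-> exp (i z_g)] restricted to [V] are then
    algebraically independent, satisfy differential equations with algebraic
    coefficients for [dim V < #|G|] derivations, and take algebraic values on the
    group generated by the rows.  Siegel's lemma gives an integer polynomial in
    them vanishing to high order at the points with coordinates in [0, S).  At the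
    first order where some derivative does not vanish, this derivative is an
    algebraic number that is too small for Liouville's inequality.

    Since the [a g] are real, the smallness estimate is one of real analysis
    (Rolle's theorem with multiplicities).  Elements of the number field are
    represented by integer matrices having a fixed common eigenvector, so that no
    field of definition has to be constructed. *)

(** * Siegel's lemma *)

(** Box principle on the vectors with entries in [0, X], where X is [#|Q| * H]. Up to a translation
    each linear form takes at most X^2 + 1 values on them, and (X^2 + 1)^#|E| < (X + 1)^#|Q|. The
    difference of two colliding vectors solves the system. *)
Lemma siegel (Q E : finType) (B : E -> Q -> int) (H : nat) :
  (0 < H)%N -> (0 < #|Q|)%N -> (2 * #|E| <= #|Q|)%N ->
  (forall e q, `|B e q|%N <= H)%N ->
  exists p : Q -> int, [/\ exists q, p q != 0,
    forall q, (`|p q| <= #|Q| * H)%N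
    & forall e, \sum_q B e q * p q = 0].
Proof.
move=> H0 Q0 QE BH; set X := (#|Q| * H)%N.
have X0 : (0 < X)%N by rewrite muln_gt0 Q0.
(* A negative coefficient has its absolute value multiplied by X - x: this translates the form by a
   constant and keeps its values in [0, X^2]. *)
pose term e q (x : nat) : nat :=
  (if (0 <= B e q)%R then `|B e q| * x else `|B e q| * (X - x))%N.
pose vl (f : {ffun Q -> 'I_X.+1}) e : nat := \sum_q term e q (f q).
have vlX f e : (vl f e < (X ^ 2).+1)%N.
  rewrite ltnS (@leq_trans (\sum_(q : Q) H * X)%N) //.
    apply: leq_sum => q _; rewrite /term; case: ifP => _;
      apply: leq_mul => //; [by rewrite -ltnS ltn_ord | exact: leq_subr].
  by rewrite sum_nat_const mulnA.
pose Phi f : {ffun E -> 'I_(X ^ 2).+1} := [ffun e => Ordinal (vlX f e)].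
have /injectivePn [f [g fg Efg]] : ~~ injectiveb Phi.
  apply/injectiveP => /leq_card; rewrite !card_ffun !card_ord leqNgt.
  move/negP; apply; have [->|E0] := posnP #|E|.
    by rewrite expn0 -[X in (X < _)%N](exp1n #|Q|) ltn_exp2r.
  apply: (@leq_trans ((X.+1 ^ 2) ^ #|E|)).
    by rewrite ltn_exp2r //; lia.
  by rewrite -expnM leq_exp2l.
exists (fun q => (f q)%:Z - (g q)%:Z); split.
- have /existsP[q fgq] : [exists q, f q != g q].
    rewrite -negb_forall; apply: contra fg => /forallP h.
    by apply/eqP/ffunP => q; apply/eqP.
  exists q; apply: contra fgq; rewrite subr_eq0 => /eqP [] h.
  exact/eqP/val_inj.
- move=> q; have := ltn_ord (f q); have := ltn_ord (g q).
  by rewrite !ltnS /X; lia.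
- move=> e; have : vl f e = vl g e by move/ffunP/(_ e): Efg; rewrite !ffunE => -[].
  have vlE (h : {ffun Q -> 'I_X.+1}) : (vl h e)%:Z = \sum_q B e q * (h q)%:Z +
      \sum_q (if 0 <= B e q then 0 else - B e q * X%:Z).
    rewrite /vl /term -big_split (big_morph Posz PoszD (erefl _)).
    apply: eq_bigr => q _ /=; have := ltn_ord (h q); rewrite ltnS.
    by case: ifP => Beq hX; rewrite PoszM -?subzn // abszE;
      [rewrite ger0_norm // addr0 | rewrite ltr0_norm ?ltNge ?Beq // mulrBr; ring].
  move=> /(congr1 Posz); rewrite !vlE => /addIr h.
  under eq_bigr do rewrite mulrBr.
  by rewrite big_split /= sumrN h subrr.
Qed.

(** * Liouville's inequality for integer matrices *)

Lemma prod_le_exp (R : numDomainType) (s : seq R) (H : R) :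
  1 <= H -> (forall z, z \in s -> `|z| <= H) -> \prod_(z <- s) `|z| <= H ^+ size s.
Proof.
move=> H1; elim: s => [|z s IH] sH; first by rewrite big_nil expr0.
rewrite big_cons exprS ler_pM ?normr_ge0 ?prodr_ge0 ?sH ?mem_head //.
by apply: IH => y ys; apply: sH; rewrite inE ys orbT.
Qed.


(** Sum the moduli of the coordinates of [a u = u A], for a left eigenvector [u], and exchange the
    sums: the l1 norm of [u] grows at most by the factor [H]. *)
Lemma eigenvalue_le_row_sum (F : numFieldType) (D : nat) (A : 'M[F]_D) (H a : F) :
  (forall i, \sum_j `|A i j| <= H) -> eigenvalue A a -> `|a| <= H.
Proof.
move=> AH /eigenvalueP[u uA u0].
have N0 : 0 < \sum_i `|u 0 i|.
  rewrite lt0r sumr_ge0 // andbT; apply: contra u0.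
  rewrite psumr_eq0 // => /allP h; apply/eqP/rowP => i; rewrite mxE.
  by apply/eqP; rewrite -normr_eq0; apply: h; rewrite mem_index_enum.
rewrite -(ler_pM2r N0) mulr_sumr.
apply: (@le_trans _ _ (\sum_j \sum_i `|u 0 i| * `|A i j|)).
  apply: ler_sum => j _; rewrite -normrM.
  have /rowP/(_ j) := uA; rewrite !mxE => <-.
  by apply: le_trans (ler_norm_sum _ _ _) _; apply: ler_sum => i _; rewrite normrM.
rewrite exchange_big mulr_sumr; apply: ler_sum => i _ /=.
by rewrite -mulr_sumr mulrC ler_wpM2r.
Qed.

Lemma char_poly_tr (R : comNzRingType) (D : nat) (A : 'M[R]_D) :
  char_poly A^T = char_poly A.
Proof.
by rewrite /char_poly -det_tr /char_poly_mx linearB /= tr_scalar_mx map_trmx trmxK.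
Qed.

(* The product of the nonzero eigenvalues of [B] is, up to sign, its lowest nonzero
   characteristic coefficient, a nonzero integer; all of them are at most [H]. *)
Lemma liouville (F : numClosedFieldType) (D : nat) (B : 'M[int]_D) (H : nat)
    (v : 'cV[F]_D) (g : F) :
  (forall i, (\sum_j `|B i j| <= H)%N) -> (0 < H)%N ->
  map_mx intr B *m v = g *: v -> v != 0 -> g != 0 ->
  1 <= `|g| * H%:R ^+ D.-1.
Proof.
move=> BH H0 Bv v0 g0; set A := map_mx intr B in Bv.
have AH i : \sum_j `|A i j| <= H%:R.
  rewrite (le_trans _ (_ : (\sum_j `|B i j|%N)%:R <= _)) ?ler_nat //.
  by rewrite natr_sum ler_sum // => j _; rewrite mxE -intr_norm -abszE.
have [rs rsE] := closed_field_poly_normal (char_poly A).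
rewrite (monicP (char_poly_monic A)) scale1r in rsE.
have size_rs : size rs = D.
  by have := size_char_poly A; rewrite rsE size_prod_XsubC => -[].
have root_rs z : root (char_poly A) z = (z \in rs).
  by rewrite rsE root_prod_XsubC.
have grs : g \in rs.
  rewrite -root_rs -char_poly_tr -eigenvalue_root_char; apply/eigenvalueP.
  exists v^T; first by rewrite -trmx_mul Bv linearZ.
  by apply: contra v0 => /eqP h; rewrite -[v]trmxK h trmx0.
pose nz := [seq z <- rs | z != 0].
have Enz : char_poly A = 'X^(count (pred1 0) rs) * \prod_(z <- nz) ('X - z%:P).
  rewrite rsE /nz big_filter (bigID (pred1 0)) /=; congr (_ * _).
  rewrite -big_filter -size_filter; set l := seq.filter _ _.
  have : all (pred1 0) l by exact: filter_all.
  elim: l => [|z l IH] /=; first by rewrite big_nil expr0.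
  by case/andP => /eqP-> /IH; rewrite big_cons subr0 => ->; rewrite exprS.
have szr : (size nz <= D)%N by rewrite -size_rs size_filter count_size.
have cE : (char_poly A)`_(count (pred1 0) rs) = \prod_(z <- nz) (- z).
  rewrite Enz coefXnM ltnn subnn -horner_coef0 horner_prod.
  by apply: eq_bigr => z _; rewrite hornerXsubC sub0r.
have : `|(char_poly A)`_(count (pred1 0) rs)| >= 1.
  have ne0 : (char_poly A)`_(count (pred1 0) rs) != 0.
    rewrite cE prodf_seq_neq0; apply/allP => z; rewrite mem_filter => /andP[? _].
    by rewrite oppr_eq0.
  move: ne0; rewrite -map_char_poly coef_map /= intr_eq0 -intr_norm => ne0.
  by rewrite -[1]/(1%:~R) ler_int -gtz0_ge1 normr_gt0.
move/le_trans; apply; rewrite cE normr_prod.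
under eq_bigr do rewrite normrN.
have gnz : g \in nz by rewrite mem_filter g0.
rewrite (perm_big _ (perm_to_rem gnz)) big_cons /=.
apply: ler_wpM2l => //.
have H1 : 1 <= H%:R :> F by rewrite ler1n.
apply: le_trans (prod_le_exp H1 _) _.
  move=> z /mem_rem; rewrite mem_filter => /andP[_ zrs].
  by apply: eigenvalue_le_row_sum AH _; rewrite eigenvalue_root_char root_rs.
apply: ler_weXn2l => //; by rewrite size_rem // -!subn1 leq_sub2r.
Qed.

(** * Algebraic integers as integer matrices *)

(** All numbers in use share the vector [v], an eigenvector of [B] with eigenvalue [z]. The row sum
    norm is subadditive and submultiplicative, so [H] acts as a bound for all conjugates of [z] at
    once (when [v] is nonzero). *)
Definition int_rep (F : numClosedFieldType) (J : finType) (v : J -> F) (H : nat) (z : F) :=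
  exists B : J -> J -> int,
    (forall j, z * v j = \sum_k (B j k)%:~R * v k) /\
    (forall j, (\sum_k `|B j k| <= H)%N).

Section IntRep.
Variables (F : numClosedFieldType) (J : finType) (v : J -> F).

Lemma int_rep_le H H' z : (H <= H')%N -> int_rep v H z -> int_rep v H' z.
Proof. by move=> HH [B [Bv BH]]; exists B; split=> // j; apply: leq_trans HH. Qed.

Lemma int_rep_int (m : int) : int_rep v `|m| m%:~R.
Proof.
exists (fun j k => if j == k then m else 0); split=> j.
  rewrite (bigD1 j) //= eqxx big1 ?addr0 // => k /negPf.
  by rewrite eq_sym => ->; rewrite mul0r.
rewrite (bigD1 j) //= eqxx big1 ?addn0 // => k /negPf.
by rewrite eq_sym => ->.
Qed.

Lemma int_repD H1 H2 x y :
  int_rep v H1 x -> int_rep v H2 y -> int_rep v (H1 + H2) (x + y).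
Proof.
move=> [B1 [Bv1 BH1]] [B2 [Bv2 BH2]]; exists (fun j k => B1 j k + B2 j k); split=> j.
  by rewrite mulrDl Bv1 Bv2 -big_split /=; under [RHS]eq_bigr do rewrite rmorphD mulrDl.
apply: leq_trans (leq_add (BH1 j) (BH2 j)); rewrite -big_split /=.
by apply: leq_sum => k _; lia.
Qed.

Lemma int_repM H1 H2 x y :
  int_rep v H1 x -> int_rep v H2 y -> int_rep v (H1 * H2) (x * y).
Proof.
move=> [B1 [Bv1 BH1]] [B2 [Bv2 BH2]].
exists (fun j k => \sum_r B2 j r * B1 r k); split=> j.
  rewrite -mulrA Bv2 mulr_sumr.
  under eq_bigr => r _ do rewrite mulrCA Bv1 mulr_sumr.
  rewrite exchange_big /=; apply: eq_bigr => k _.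
  by rewrite rmorph_sum mulr_suml; apply: eq_bigr => r _; rewrite rmorphM mulrA.
apply: (@leq_trans (\sum_k \sum_r `|B2 j r| * `|B1 r k|)%N).
  apply: leq_sum => k _; apply: (big_ind2 (fun (a : int) b => `|a| <= b)%N) => //.
    by move=> a b a' b' ? ?; lia.
  by move=> r _; rewrite abszM.
rewrite exchange_big /= mulnC (leq_trans _ (_ : (\sum_r `|B2 j r| * H1 <= _)%N)) //.
  by apply: leq_sum => r _; rewrite -big_distrr /= leq_mul2l BH1 orbT.
by rewrite -big_distrl /= leq_mul2r BH2 orbT.
Qed.

Lemma int_repX H x n : int_rep v H x -> int_rep v (H ^ n) (x ^+ n).
Proof.
by move=> xH; elim: n => [|n IH]; [apply: (int_rep_int 1) | rewrite exprS expnS; apply: int_repM].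
Qed.

Lemma int_rep_sum (I : Type) (r : seq I) (P : pred I) (H : I -> nat) (f : I -> F) :
  (forall i, P i -> int_rep v (H i) (f i)) ->
  int_rep v (\sum_(i <- r | P i) H i) (\sum_(i <- r | P i) f i).
Proof.
move=> h; apply: (big_ind2 (int_rep v)) => //; first exact: (int_rep_int 0).
by move=> *; apply: int_repD.
Qed.

Lemma int_rep_prod (I : Type) (r : seq I) (P : pred I) (H : I -> nat) (f : I -> F) :
  (forall i, P i -> int_rep v (H i) (f i)) ->
  int_rep v (\prod_(i <- r | P i) H i) (\prod_(i <- r | P i) f i).
Proof.
move=> h; apply: (big_ind2 (int_rep v)) => //; first exact: (int_rep_int 1).
by move=> *; apply: int_repM.
Qed.

Lemma int_rep_liouville H z j0 : v j0 != 0 -> (0 < H)%N -> int_rep v H z -> z != 0 ->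
  1 <= `|z| * H%:R ^+ #|J|.-1.
Proof.
move=> vj0 H0 [B [Bv BH]] z0.
apply: (@liouville _ _ (\matrix_(i, j) B (enum_val i) (enum_val j)) _
         (\col_i v (enum_val i))) => //.
- move=> i; rewrite (leq_trans _ (BH (enum_val i))) //.
  rewrite [leqRHS](reindex (@enum_val J J)) /=; last first.
    by apply: onW_bij; apply: enum_val_bij.
  by rewrite leq_sum // => j _; rewrite mxE.
- apply/colP => i; rewrite !mxE Bv.
  rewrite [RHS](reindex (@enum_val J J)) /=; last first.
    by apply: onW_bij; apply: enum_val_bij.
  by apply: eq_bigr => j _; rewrite !mxE.
- apply: contra vj0 => /eqP/colP/(_ (enum_rank j0)).
  by rewrite !mxE enum_rankK => ->.
Qed.

End IntRep.

(* [v] runs over the monomials in the [z], with exponents below the degrees of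
   their integral equations. *)
Lemma int_rep_exists (F : numClosedFieldType) (s : seq F) :
  (forall z, z \in s -> integralOver (intr : int -> F) z) ->
  exists (J : finType) (v : J -> F) (j0 : J) (H : nat),
    v j0 = 1 /\ forall z, z \in s -> int_rep v H z.
Proof.
elim: s => [|z s IH] hs; first by exists unit, (fun=> 1), tt, 0%N.
have [|J [v [j0 [H [vj0 sv]]]]] := IH.
  by move=> y ys; apply: hs; rewrite inE ys orbT.
have [q q_mon qz] := hs z (mem_head z s).
have szq : (1 < size q)%N.
  rewrite ltnNge; apply/negP => /size1_polyC qE.
  move: q_mon qz; rewrite qE monicE lead_coefC => /eqP->.
  by rewrite map_polyC rootC oner_eq0.
pose e := (size q).-2.
have sqE : size q = e.+2 by rewrite /e; case: (size q) szq => [|[|n]].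
pose v' (x : J * 'I_e.+1) := v x.1 * z ^+ x.2.
have zE : z ^+ e.+1 = \sum_(i < e.+1) (- q`_i)%:~R * z ^+ i.
  move: qz; rewrite rootE horner_coef size_map_poly_id0; last first.
    by rewrite (monicP q_mon) oner_eq0.
  rewrite sqE big_ord_recr /= coef_map /=.
  have -> : q`_e.+1 = 1 by move: (monicP q_mon); rewrite lead_coefE sqE.
  rewrite mul1r addrC addr_eq0 => /eqP->; rewrite -sumrN.
  by apply: eq_bigr => i _; rewrite coef_map /= rmorphN mulNr.
(* [Bz] is the companion matrix of [q], repeated along [J]: powers of [z] below the top one shift
   up, and the top one is reduced by [zE]. [lift] lets the older matrices act on [J] alone. *)
pose Bz (x y : J * 'I_e.+1) : int := if x.1 != y.1 then 0 else
  if (x.2 < e)%N then (y.2 == x.2.+1 :> nat)%:R else - q`_y.2.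
pose lift (B : J -> J -> int) (x y : J * 'I_e.+1) : int :=
  if x.2 == y.2 then B x.1 y.1 else 0.
exists (J * 'I_e.+1)%type, v', (j0, ord0),
  (maxn H (\max_x \sum_y `|Bz x y|)%N); split; first by rewrite /v' /= vj0 expr0 mulr1.
move=> y; rewrite inE => /predU1P[->|ys].
  apply: int_rep_le (leq_maxr _ _) _; exists Bz; split; last first.
    by move=> x; apply: (@leq_bigmax _ (fun x => \sum_y `|Bz x y|)%N).
  move=> [j i]; rewrite /v' /=.
  rewrite -(pair_bigA _ (fun k l => (Bz (j, i) (k, l))%:~R * (v k * z ^+ l))) /=.
  rewrite (bigD1 j) //= [X in _ + X]big1 ?addr0; last first.
    by move=> k kj; apply: big1 => l _; rewrite /Bz /= eq_sym kj mul0r.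
  rewrite /Bz /= eqxx /=; have [ie|ie] := ltnP i e.
    rewrite (bigD1 (inord i.+1)) //= inordK ?ltnS // eqxx [X in _ + X]big1 ?addr0.
      by rewrite mul1r mulrCA exprS.
    move=> l /eqP li; case: eqP => [li'|]; last by rewrite mul0r.
    by case: li; apply: val_inj; rewrite /= inordK.
  have -> : i = e :> nat by apply/eqP; rewrite eqn_leq ie -ltnS ltn_ord.
  rewrite mulrCA -exprS zE mulr_sumr.
  by apply: eq_bigr => l _; rewrite mulrCA.
apply: int_rep_le (leq_maxl _ _) _; have [B [Bv BH]] := sv _ ys.
exists (lift B); split; move=> [j i]; rewrite /lift /v' /=.
  rewrite -(pair_bigA _ (fun k (l : 'I_e.+1) =>
    (if i == l then B j k else 0)%:~R * (v k * z ^+ l))) /=.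
  rewrite mulrA Bv mulr_suml; apply: eq_bigr => k _.
  rewrite (bigD1 i) //= eqxx [X in _ + X]big1 ?addr0 ?mulrA // => l.
  by rewrite eq_sym => /negPf->; rewrite mul0r.
rewrite -(pair_bigA _ (fun k (l : 'I_e.+1) => `|if i == l then B j k else 0|%N)) /=.
apply: leq_trans (BH j); apply: leq_sum => k _.
rewrite (bigD1 i) //= eqxx big1 ?addn0 // => l.
by rewrite eq_sym => /negPf->.
Qed.

(** * Choice of the parameters *)

Local Open Scope nat_scope.

Lemma fact_geq (m a : nat) : m`! * m ^ a <= (m + a)`!.
Proof.
elim: a => [|a IH]; first by rewrite expn0 muln1 addn0.
rewrite addnS factS expnS mulnCA leq_mul //; lia.
Qed.

(** The factorial on the right is at least m! m^(mS), and m >= W (S+1)^2 X. The powers of W (S+1)^2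
    pay for the growth of the derivatives and for the nodes; what remains is X^(mS) >= X^(Ck), since
    C M <= S and k <= M m. This turns the analytic estimate into a decay by X^(-Ck). *)
Lemma extrapolation_gain (q P W S X M C k m : nat) :
  0 < X -> 0 < S -> C * M <= S -> m <= k -> k <= M * m -> W * S.+1 ^ 2 * X * M <= k ->
  0 < m ->
  q * (P * W ^ (k - m)) * W ^ (m * S.+1) * (m`! * S.+1 ^ (m * S.+1)) * X ^ (C * k)
    <= q * P * W ^ k * (m * S.+1)`!.
Proof.
move=> X0 S0 CM mk kM Wk m0.
have M0 : 0 < M by case: M kM {CM Wk} => //; lia.
have WSm : W * S.+1 ^ 2 * X <= m by rewrite -(leq_pmul2l M0) mulnC (leq_trans Wk).
apply: (@leq_trans (q * P * W ^ k * (m`! * (W * S.+1 ^ 2 * X) ^ (m * S)))); last first.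
  rewrite leq_mul2l mulnS; apply/orP; right.
  by apply: leq_trans (fact_geq _ _); rewrite leq_mul2l leq_exp2r ?WSm ?orbT // muln_gt0 m0.
have -> : W ^ (m * S.+1) = W ^ m * W ^ (m * S) by rewrite mulnS expnD.
have -> : W ^ k = W ^ (k - m) * W ^ m by rewrite -expnD subnK.
rewrite expnMn expnMn -expnM.
have hS : S.+1 ^ (m * S.+1) <= S.+1 ^ (2 * (m * S)) by rewrite leq_pexp2l //; nia.
have hX : X ^ (C * k) <= X ^ (m * S) by rewrite leq_pexp2l //; nia.
have := leq_mul hS hX.
set a := S.+1 ^ (m * _); set b := S.+1 ^ _; set c := X ^ _; set d := X ^ _ => abcd.
set w1 := W ^ (k - m); set w2 := W ^ m; set w3 := W ^ (m * S).
have -> : q * (P * w1) * (w2 * w3) * (m`! * a) * c = q * P * (w1 * w2) * (m`! * w3) * (a * c) by ring.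
have -> : q * P * (w1 * w2) * (m`! * (w3 * b * d)) = q * P * (w1 * w2) * (m`! * w3) * (b * d) by ring.
by rewrite leq_mul2l abcd orbT.
Qed.

(* [T = X^(2N)] and [L = b X^(2N-2)], with [X] large in terms of all other data. *)
Lemma parameters (N n M K H delta c cA : nat) :
  n < N -> 0 < K -> exists C S T L X : nat,
  [/\ 0 < T, 0 < L, 0 < S, C * M <= S & 0 < X] /\
  2 * (T ^ n * S.+1 ^ M * K) <= L ^ N /\
  forall k, T <= k ->
    let W := N * cA * L in
    let D := M * N * L * S.+1 in
    let P := L ^ N * ((N * L * H) ^ (n * T) * H ^ D) in
    W * S.+1 ^ 2 * X * M <= k /\
    delta ^ D * (M * c) ^ k * (L ^ N * P * W ^ k) *
      (L ^ N * P * (N * L * H) ^ k * H ^ D) ^ K.-1 < X ^ (C * k).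
Proof.
move=> nN K0.
(* [P] will be at most X^(eP k). The terms of [C] are the exponents of the factors to be beaten; its
   final successor makes the inequality strict. *)
pose eP := 2 * N ^ 2 + 2.
pose C := (1 + 1 + (1 + eP + 2 * N) + (1 + eP + 2 * N + 1) * K.-1).+1.
pose S := (C * M).+1.
(* Siegel's condition compares L^N = b^N X^(2N(N-1)) with a constant times T^n, where n <= N - 1;
   [b] is that constant. [C], [S] and [b] are fixed before [X]. *)
pose b := 2 * K * S.+1 ^ M.
have b0 : 0 < b by rewrite !muln_gt0 K0 expn_gt0.
have bE : b = 2 * K * S.+1 ^ M by [].
have [X [X1 [hX1 [hX2 [hX3 [hX4 [hX5 [hX6 [hX7 [hX8 hX9]]]]]]]]]] : exists X, 1 < X /\
    M * N * S.+1 * b <= X /\ M * c <= X /\ 2 * N ^ 2 <= X /\ N * b * H <= X /\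
    N * cA * b <= X /\ N * cA * b * S.+1 ^ 2 * M <= X /\ delta <= X /\ H <= X /\ b <= X.
  by exists (M * N * S.+1 * b + M * c + 2 * N ^ 2 + N * b * H + N * cA * b +
    N * cA * b * S.+1 ^ 2 * M + delta + H + b + 2); lia.
clearbody b; have X0 : 0 < X by lia.
have N0 : 0 < N by lia.
have SE : C * M <= S by exact: leqnSn.
have CE : C = (1 + 1 + (1 + eP + 2 * N) + (1 + eP + 2 * N + 1) * K.-1).+1 by [].
have S0 : 0 < S by [].
clearbody S C.
(* Now T = X^2 Y and L = b Y. A quantity a Y with a <= X is at most k and at most X^(2N); the
   quantities linear in [L] are all bounded in this way. *)
have [Y YE] : exists Y, Y = X ^ (2 * N).-2 by exists (X ^ (2 * N).-2).
have Y0 : 0 < Y by rewrite YE expn_gt0 X0.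
have [T TE0] : exists T, T = X ^ (2 * N) by exists (X ^ (2 * N)).
have TE : T = X ^ 2 * Y by rewrite YE -expnD TE0; congr (_ ^ _); lia.
have T0 : 0 < T by rewrite TE0 expn_gt0 X0.
have [L LE] : exists L, L = b * Y by exists (b * Y).
have L0 : 0 < L by rewrite LE muln_gt0 b0.
exists C, S, T, L, X; split => //; split.
  rewrite LE YE expnMn -expnM.
  have hT : T ^ n <= X ^ ((2 * N).-2 * N) by rewrite TE0 -expnM leq_pexp2l //; nia.
  have hb : b <= b ^ N by rewrite -{1}(expn1 b) leq_pexp2l //; lia.
  apply: leq_trans (leq_mul hb hT); rewrite bE.
  by rewrite leq_eqVlt; apply/orP; left; apply/eqP; ring.
move=> k Tk W D P.
have XT a : a <= X -> a * Y * X <= k.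
  move=> aX; apply: leq_trans Tk; rewrite TE expnS expn1.
  by rewrite -mulnA [Y * X]mulnC mulnA !leq_mul.
have XT1 a : a <= X -> a * Y <= k.
  by move=> aX; apply: leq_trans (XT a aX); rewrite leq_pmulr.
have Tpow a : a <= X -> a * Y <= X ^ (2 * N).
  move=> aX; rewrite -TE0 TE expnS expn1 leq_mul //.
  by apply: leq_trans aX _; rewrite leq_pmulr.
have Wle : W * S.+1 ^ 2 * X * M <= k.
  apply: leq_trans (XT _ hX6); rewrite /W LE.
  by rewrite leq_eqVlt; apply/orP; left; apply/eqP; ring.
split=> //.
have Dk : D <= k.
  apply: leq_trans (XT1 _ hX1); rewrite /D LE.
  by rewrite leq_eqVlt; apply/orP; left; apply/eqP; ring.
have powk a e j : a <= X -> j <= e * k -> a ^ j <= X ^ (e * k).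
  move=> aX je; apply: (@leq_trans (X ^ j)); last by rewrite leq_pexp2l.
  by have [->|j0] := posnP j; rewrite ?expn0 // leq_exp2r.
have powk2 a e j : a <= X ^ (2 * N) -> j <= e -> a ^ j <= X ^ (2 * N * e).
  move=> aX jk; apply: (@leq_trans ((X ^ (2 * N)) ^ j)).
    by have [->|j0] := posnP j; rewrite ?expn0 // leq_exp2r.
  by rewrite -expnM leq_pexp2l // leq_mul2l jk orbT.
have kX : 2 * N ^ 2 <= k.
  by apply: (@leq_trans (2 * N ^ 2 * Y)); [rewrite leq_pmulr|apply: XT1].
have hL : L <= X ^ (2 * N) by rewrite LE; apply: Tpow.
have hNLH : N * L * H <= X ^ (2 * N).
  by rewrite LE mulnA mulnAC; apply: Tpow.
have hW : W <= X ^ (2 * N) by rewrite /W LE mulnA; apply: Tpow.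
have hdelta : delta ^ D <= X ^ (1 * k) by apply: powk; rewrite ?mul1n.
have hH : H ^ D <= X ^ (1 * k) by apply: powk; rewrite ?mul1n.
have hMc : (M * c) ^ k <= X ^ (1 * k) by apply: powk; rewrite ?mul1n.
have hLN : L ^ N <= X ^ (1 * k).
  apply: (leq_trans (powk2 _ _ _ hL (leqnn N))).
  by rewrite leq_pexp2l // mul1n -mulnA.
have Tn : n * T <= N * k by rewrite leq_mul // ltnW.
have hP : P <= X ^ (eP * k).
  have -> : eP * k = 1 * k + (2 * N * (N * k) + 1 * k) by rewrite /eP; ring.
  by rewrite 2!expnD /P leq_mul // leq_mul // powk2.
have hWk : W ^ k <= X ^ (2 * N * k) by apply: powk2.
have hNLHk : (N * L * H) ^ k <= X ^ (2 * N * k) by apply: powk2.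
have k0 : 0 < k by apply: leq_trans Tk.
apply: (@leq_ltn_trans (X ^ (C.-1 * k))); last first.
  by rewrite ltn_exp2l // ltn_mul2r k0 CE /=.
have -> : C.-1 * k = 1 * k + 1 * k + (1 * k + eP * k + 2 * N * k) +
    (1 * k + eP * k + 2 * N * k + 1 * k) * K.-1 by rewrite CE /=; ring.
rewrite [X ^ (_ + _ * _)]expnD [X ^ (_ * K.-1)]expnM leq_mul //.
  by rewrite 4!expnD !leq_mul.
have [->|K1] := posnP K.-1; first by rewrite !expn0.
by rewrite leq_exp2r // 3!expnD !leq_mul.
Qed.

Local Open Scope ring_scope.

(** * A Schwarz estimate from Rolle's theorem *)

(** A node listed k + 1 times is a zero of [f 0], ..., [f k]. Rolle yields a zero of [f 1] between
    distinct neighbours, and a repeated node is its own intermediate point. The intermediate points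
    satisfy the same hypotheses for the shifted family, with one node fewer. *)
Lemma rolle_mult (R : realType) (M : nat) (f : nat -> R -> R) (x : nat -> R) :
  (forall k t, is_derive t (1 : R) (f k) (f k.+1 t)) ->
  {homo x : i j / (i <= j)%N >-> i <= j} ->
  (forall i k, (i + k <= M)%N -> x i = x (i + k)%N -> f k (x i) = 0) ->
  exists t, f M t = 0.
Proof.
elim: M f x => [|M IH] f x df x_mono fx0; first by exists (x 0%N); apply: fx0.
have yP i : exists y, [/\ x i <= y <= x i.+1, x i < x i.+1 -> x i < y < x i.+1
    & (i <= M)%N -> f 1%N y = 0].
  have [xlt|xge] := ltP (x i) (x i.+1); last first.
    have xE : x i = x i.+1 by apply/eqP; rewrite eq_le xge x_mono.
    exists (x i); rewrite -xE lexx; split=> // iM.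
    by apply: fx0; rewrite ?addn1.
  (* Past the last node no zero is required; the midpoint only keeps [y] strictly between distinct
     neighbours. *)
  have [iM|iM] := leqP i M; last first.
    exists ((x i + x i.+1) / 2); have := midf_lt xlt.
    by move=> [h1 h2]; split=> //; rewrite ?h1 ?h2 ?ltW.
  have [] := @Rolle R (f 0%N) _ _ xlt.
  - by move=> t _; have := df 0%N t; case.
  - by apply: derivable_within_continuous => t _; have := df 0%N t; case.
  - by rewrite !(fx0 _ 0%N) ?addn0 // ltnW.
  move=> c; rewrite in_itv /= => /andP[xc cx] [_ dc]; exists c.
  by split; rewrite ?xc ?cx ?ltW //; have [_ <-] := df 0%N c.
have [y yx] := choice yP.
have yge i : x i <= y i by have [/andP[]] := yx i.
have yle i : y i <= x i.+1 by have [/andP[]] := yx i.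
have yE i : y i = x i \/ y i = x i.+1 -> x i = x i.+1.
  have [_ h _] := yx i; have [//|xn hy] := eqVneq (x i) (x i.+1).
  have /h/andP[h1 h2] : x i < x i.+1 by rewrite lt_neqAle xn x_mono.
  by case: hy => e; [move: h1|move: h2]; rewrite e ltxx.
apply: (IH (fun k => f k.+1) y) => //.
  apply: homo_leq => //; first exact: le_trans.
  by move=> i; apply: le_trans (yle _) (yge _).
move=> i [|k] ik yik; first by have [_ _] := yx i; apply; rewrite addn0 in ik.
rewrite addnS in yik ik.
have h1 : x i.+1 <= x (i + k).+1 by apply: x_mono; lia.
have h2 := yle i; have h3 := yge (i + k).+1.
have e1 : y i = x i.+1 by lra.
have e2 : y (i + k).+1 = x (i + k).+1 by lra.
have e3 := yE _ (or_intror e1).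
rewrite e1 -e3; apply: fx0; first lia.
rewrite !addnS -(yE (i + k).+1); last by left.
by rewrite -e2 -yik e1.
Qed.

(** Each derivation costs one factor X - a. This gives the vanishing at [a] for k < m and the value
    m! q(a) for k = m. *)
Lemma derivn_XsubCn_mul (R : comNzRingType) (a : R) (q : {poly R}) (m k : nat) :
  (k <= m)%N -> exists r : {poly R},
    (('X - a%:P) ^+ m * q)^`(k) = ('X - a%:P) ^+ (m - k) * r /\
    r.[a] = (m ^_ k)%:R * q.[a].
Proof.
elim: k => [|k IH] km; first by exists q; rewrite subn0 ffactn0 mul1r.
have [|r [rE ra]] := IH; first exact: ltnW.
have mk : (m - k = (m - k.+1).+1)%N by lia.
exists ((m - k)%:R *: r + ('X - a%:P) * r^`()); split.
  rewrite derivnS rE derivM deriv_exp derivXsubC mul1r mk /=.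
  by rewrite -scaler_nat -scalerAl mulrDr -scalerAr exprSr -mulrA.
by rewrite !hornerE subrr mul0r addr0 ra ffactnSr natrM; ring.
Qed.

Lemma derivn_monic_size (R : nzRingType) (p : {poly R}) n x :
  p \is monic -> size p = n.+1 -> p^`(n).[x] = n`!%:R.
Proof.
move=> p_mon sz; have -> : p^`(n) = (n`!%:R)%:P.
  apply/polyP => i; rewrite coef_derivn coefC; case: i => [|i].
    rewrite addn0 ffactnn /=.
    by move: p_mon; rewrite monicE lead_coefE sz => /eqP ->.
  by rewrite nth_default ?mul0rn // sz addnS ltnS leq_addr.
by rewrite hornerC.
Qed.

Lemma normc_real (R : rcfType) (x : R) : `|x%:C%C| = (`|x|%:C)%C :> R[i].
Proof. by rewrite normc_def /= expr0n /= addr0 sqrtr_sqr. Qed.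

Definition expi (R : realType) (t : R) : R[i] := (cos t +i* sin t)%C.

Section Expi.
Variable R : realType.
Implicit Types (t : R).

Lemma expiD t u : expi (t + u) = expi t * expi u.
Proof. by rewrite /expi trigo.cosD trigo.sinD; apply/eqP; rewrite eq_complex /= eqxx addrC eqxx. Qed.

Lemma expi0 : expi 0 = 1 :> R[i].
Proof. by rewrite /expi cos0 sin0. Qed.

Lemma expi_norm t : `|expi t| = 1.
Proof. by rewrite normc_def /= cos2Dsin2 sqrtr1. Qed.

Lemma expiMn t n : expi (t *+ n) = expi t ^+ n.
Proof. by elim: n => [|n IH]; rewrite ?mulr0n ?expi0 // mulrS exprS expiD IH. Qed.

Lemma expi_sum (I : Type) (r : seq I) (P : pred I) (f : I -> R) :
  expi (\sum_(i <- r | P i) f i) = \prod_(i <- r | P i) expi (f i).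
Proof. exact: (big_morph _ expiD expi0). Qed.

Lemma is_derive_expi_sum (I : Type) (r : seq I) (q : I -> R[i]) (w : I -> R) t :
  is_derive t (1 : R) (fun t => \sum_(i <- r) complex.Re (q i * expi (w i * t)))
    (\sum_(i <- r) complex.Re ('i%C * (w i)%:C%C * q i * expi (w i * t))).
Proof.
elim: r => [|i r IH].
  by rewrite big_nil; under eq_fun do rewrite big_nil; exact: is_derive_cst.
rewrite big_cons; under eq_fun do rewrite big_cons.
apply: is_deriveD; rewrite /expi.
case: (q i) => a b /=.
have hl : is_derive t (1 : R) (fun x => w i * x) (w i).
  have := @is_deriveZ _ _ _ (@id R) (w i) t 1 1 _.
  by rewrite /GRing.scale /= mulr1; apply; exact: is_derive_id.
have hc : is_derive t (1 : R) (fun x => cos (w i * x)) (- sin (w i * t) * w i).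
  exact: (@is_derive1_comp _ (@cos R) _ _ _ _ (is_derive_cos _) hl).
have hs : is_derive t (1 : R) (fun x => sin (w i * x)) (cos (w i * t) * w i).
  exact: (@is_derive1_comp _ (@sin R) _ _ _ _ (is_derive_sin _) hl).
set df := (X in is_derive _ _ _ X).
have -> : df = a *: (- sin (w i * t) * w i) - b *: (cos (w i * t) * w i).
  by rewrite /df /GRing.scale /=; ring.
by apply: is_deriveB; exact: is_deriveZ.
Qed.

End Expi.

(* The nodes are [0, ..., S - 1], each repeated [m] times, except [j0], which is
   repeated [m + 1] times. *)
Lemma hermite_node_mult (S m j0 i k : nat) :
  let n i := ((if i < j0.+1 * m then i else i.-1) %/ m)%N in
  (0 < m)%N -> (j0 < S)%N -> (i + k <= m * S)%N -> n i = n (i + k)%N ->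
  (n i < S)%N /\ ((k < m)%N \/ k = m /\ n i = j0).
Proof.
move=> n m0 j0S ikM nE.
have divE a : (a %/ m * m <= a < (a %/ m).+1 * m)%N.
  by rewrite leq_divM ltn_ceil.
have := nE; rewrite /n => nE'.
set a := (if (i < _)%N then _ else _) in nE' *.
set b := (if (i + k < _)%N then _ else _) in nE'.
have aE := divE a; have bE := divE b; rewrite -nE' in bE.
set j := (a %/ m)%N in aE bE *.
move: aE bE; rewrite /a /b; clearbody j; clear -m0 j0S ikM.
by case: ifP; case: ifP; nia.
Qed.

(* Compare the sum, as a function [f] of the exponent [t], with the multiple
   [kap * P] of [P = prod_l (X - l)^m] that has the same [m]-th derivative at [j0]:
   Rolle then gives [f^(m S)(t) = kap * (m S)!] for some [t]. *)
Lemma exp_sum_schwarz (R : realType) (I : finType) (q : I -> R[i]) (w : I -> R)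
    (S m j0 Q W : nat) :
  (0 < m)%N -> (j0 < S)%N ->
  (forall i, `|w i| <= W%:R) -> \sum_i `|q i| <= Q%:R ->
  (forall j k, (j < S)%N -> (k < m)%N ->
     \sum_i q i * (w i)%:C%C ^+ k * expi (w i * j%:R) = 0) ->
  `|\sum_i q i * (w i)%:C%C ^+ m * expi (w i * j0%:R)| * (m * S)`!%:R
    <= (Q * W ^ (m * S) * (m`! * S ^ (m * S)))%:R.
Proof.
move=> m0 j0S wW qQ zero; set z := \sum_i _.
have [->|z0] := eqVneq z 0; first by rewrite normr0 mul0r.
(* This number of modulus one turns the [m]-th derivative at [j0] into the real number |z|, so
   taking real parts loses nothing there. *)
pose e := z^* / `|z| / 'i%C ^+ m.
have i_norm : `|'i%C : R[i]| = 1 by rewrite normc_def /= expr0n /= add0r expr1n sqrtr1.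
have i0 : 'i%C != 0 :> R[i] by rewrite -normr_eq0 i_norm oner_eq0.
have e_norm : `|e| = 1.
  rewrite /e !normrM !normfV normrX i_norm expr1n invr1 mulr1 normr_id.
  by rewrite norm_conjC mulfV // normr_eq0.
have ez : 'i%C ^+ m * (e * z) = `|z|.
  rewrite /e mulrCA !mulrA mulfVK ?expf_neq0 // mulrAC -[X in X / _]mulrC.
  by rewrite -normCK expr2 mulfK // normr_eq0.
clearbody e.
pose f k t := \sum_i complex.Re (('i%C * (w i)%:C%C) ^+ k * (e * q i) * expi (w i * t)).
have df k t : is_derive t (1 : R) (f k) (f k.+1 t).
  have := is_derive_expi_sum (index_enum I) (fun i => ('i%C * (w i)%:C%C) ^+ k * (e * q i)) w t.
  congr (is_derive _ _ _ _); apply: eq_bigr => i _; congr (complex.Re (_ * _)).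
  by rewrite exprS !mulrA.
have fE k t : f k t = complex.Re ('i%C ^+ k * (e * \sum_i q i * (w i)%:C%C ^+ k * expi (w i * t))).
  rewrite !mulr_sumr raddf_sum; apply: eq_bigr => i _; congr complex.Re.
  by rewrite exprMn; ring.
have Re_le (x : R[i]) : (`|complex.Re x|%:C)%C <= `|x|.
  by rewrite normc_def lecR -sqrtr_sqr ler_wsqrtr // lerDl sqr_ge0.
pose rest (j : 'I_S) : {poly R} := \prod_(l < S | l != j) ('X - (l%:R)%:P) ^+ m.
pose P : {poly R} := \prod_(l < S) ('X - (l%:R)%:P) ^+ m.
have PE (j : 'I_S) : P = ('X - (j%:R)%:P) ^+ m * rest j by rewrite /P (bigD1 j).
have P_monic : P \is monic.
  by apply: monic_prod => l _; apply: monic_exp; apply: monicXsubC.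
have P_size : size P = (m * S).+1.
  rewrite /P size_prod => [|l _]; last by rewrite expf_neq0 // polyXsubC_eq0.
  under eq_bigr do rewrite size_exp_XsubC.
  by rewrite sum_nat_const card_ord; lia.
pose c := P^`(m).[j0%:R].
have [r [rE ra]] := derivn_XsubCn_mul (j0%:R) (rest (Ordinal j0S)) (leqnn m).
rewrite subnn mul1r -[('X - _) ^+ m * _](PE (Ordinal j0S)) in rE.
have cE : c = m`!%:R * (rest (Ordinal j0S)).[j0%:R] by rewrite /c rE ra ffactnn.
have c_le : `|c| <= (m`! * S ^ (m * S))%:R.
  rewrite cE normrM natrM normr_nat ler_wpM2l ?ler0n // horner_prod normr_prod.
  apply: (@le_trans _ _ (\prod_(l < S | l != Ordinal j0S) (S%:R ^+ m))).
    apply: ler_prod => l _; rewrite normr_ge0 horner_exp hornerXsubC normrX /=.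
    apply: lerXn2r; rewrite ?nnegrE ?ler0n //.
    have := ltn_ord l; have /ltnW := j0S => h1 /ltnW h2.
    by rewrite ler_norml; move: h1 h2; rewrite -!(ler_nat R); have := ler0n R l; have := ler0n R j0; lra.
  rewrite prodr_const -exprM -natrX ler_nat leq_pexp2l //; first lia.
  by rewrite leq_mul2l; apply/orP; right; rewrite -[leqRHS]card_ord max_card.
have c0 : c != 0.
  rewrite cE mulf_neq0 ?pnatr_eq0 -?lt0n ?fact_gt0 // horner_prod.
  apply/prodf_neq0 => l lj; rewrite horner_exp hornerXsubC expf_neq0 //.
  rewrite subr_eq0 eqr_nat; apply: contra lj => /eqP jl.
  by apply/eqP/val_inj.
pose kap := f m j0%:R / c.
pose g k t := f k t - kap * P^`(k).[t].
have dg k t : is_derive t (1 : R) (g k) (g k.+1 t).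
  by rewrite /g derivnS; apply: is_deriveB.
pose n i := ((if i < j0.+1 * m then i else i.-1) %/ m)%N.
have [||t gt] := @rolle_mult R (m * S) g (fun i => (n i)%:R) dg.
- move=> a b ab; rewrite ler_nat /n; apply: leq_div2r.
  by case: ifP; case: ifP; lia.
- move=> i k ikM /eqP; rewrite eqr_nat => /eqP nE.
  have [nS nk] := hermite_node_mult m0 j0S ikM nE.
  rewrite -/(n i) in nS nk; case: nk => [km|[-> ->]]; last first.
    by rewrite /g /kap divfK // subrr.
  rewrite /g fE zero // !mulr0 raddf0.
  have [r' [r'E _]] := derivn_XsubCn_mul (n i)%:R (rest (Ordinal nS)) (ltnW km).
  rewrite (PE (Ordinal nS)) r'E hornerM horner_exp hornerXsubC subrr expr0n.
  by rewrite subn_eq0 leqNgt km mul0r mulr0 subr0.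
have f_le : `|f (m * S)%N t| <= (Q * W ^ (m * S))%:R.
  rewrite fE -lecR; apply: le_trans (Re_le _) _.
  rewrite !normrM normrX i_norm e_norm expr1n !mul1r.
  apply: le_trans (ler_norm_sum _ _ _) _.
  rewrite rmorph_nat natrM.
  apply: le_trans (_ : (\sum_i `|q i|) * (W ^ (m * S))%:R <= _); last first.
    by rewrite ler_wpM2r.
  rewrite mulr_suml; apply: ler_sum => i _; rewrite !normrM expi_norm mulr1.
  rewrite ler_wpM2l // normrX natrX lerXn2r ?nnegrE //.
  by rewrite normc_real -(rmorph_nat (real_complex R)) lecR.
have kapM : f (m * S)%N t = kap * (m * S)`!%:R.
  apply/eqP; rewrite -subr_eq0 -gt /g.
  by rewrite (derivn_monic_size t P_monic P_size).
have zE : f m j0%:R = complex.Re `|z| by rewrite fE ez.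
have zR : `|z| = ((kap * c)%:C)%C.
  by rewrite /kap divfK // zE normc_def.
have : `|kap * c| * (m * S)`!%:R <= (Q * W ^ (m * S) * (m`! * S ^ (m * S)))%:R.
  rewrite normrM mulrAC natrM -[X in _ * X * _]normr_nat -normrM -kapM.
  by apply: ler_pM.
rewrite -lecR rmorphM !rmorph_nat /=; apply: le_trans.
by rewrite ler_wpM2r // -[leLHS]normr_id zR normc_real.
Qed.

(** * Words of derivations *)

Section Words.
(* Words stand for iterated derivations: the derivation [i] multiplies the
   exponential with index [x] by [u x i]. *)
Variables (F : fieldType) (X I J : finType) (q : X -> F) (u : X -> I -> F).

Lemma prod_word (x : X) (s : seq I) :
  \prod_(i <- s) u x i = \prod_i u x i ^+ count_mem i s.
Proof.
elim: s => [|j s IH]; first by rewrite big_nil big1.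
rewrite big_cons IH [RHS](bigD1 j) //= eqxx exprS -mulrA; congr (_ * _).
rewrite (bigD1 j) //=; congr (_ * _); apply: eq_bigr => i /negPf.
by rewrite eq_sym => ->.
Qed.

(** Words are the monomials in the coordinates [u x i], and polynomials separate distinct points.
    Applied at the origin, it makes the first order of nonvanishing finite. *)
Lemma words_separate :
  (forall x y, x != y -> exists i, u x i != u y i) ->
  (forall s : seq I, \sum_x q x * \prod_(i <- s) u x i = 0) -> forall x, q x = 0.
Proof.
move=> u_sep q0 x.
(* A relation against all words holds against all products of [u y i - c]; one of
   these isolates [x]. *)
have gen (t : seq (I * F)) s :
    \sum_y q y * (\prod_(i <- s) u y i * \prod_(c <- t) (u y c.1 - c.2)) = 0.
  elim: t s => [|c t IH] s.
    by rewrite -[RHS](q0 s); apply: eq_bigr => y _; rewrite big_nil mulr1.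
  have := IH (c.1 :: s); have /(congr1 (fun z => c.2 * z)) := IH s.
  rewrite mulr0 mulr_sumr => h1 h2.
  have := congr2 (fun a b => a - b) h2 h1; rewrite subr0 -sumrB; apply: etrans.
  by apply: eq_bigr => y _; rewrite !big_cons; ring.
have [t [tx ty]] : exists t : seq (I * F), \prod_(c <- t) (u x c.1 - c.2) != 0 /\
    forall y, y \in enum X -> y != x -> \prod_(c <- t) (u y c.1 - c.2) = 0.
  elim: (enum X) => [|y e [t [tx te]]].
    by exists [::]; rewrite big_nil oner_neq0; split.
  have [->|yx] := eqVneq y x.
    by exists t; split=> // z; rewrite inE => /predU1P[->|/te//]; rewrite eqxx.
  have [i ui] := u_sep _ _ yx; exists ((i, u y i) :: t).
  split; first by rewrite big_cons mulf_neq0 //= subr_eq0 eq_sym.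
  move=> z; rewrite inE big_cons => /predU1P[->|ze] zx.
    by rewrite /= subrr mul0r.
  by rewrite te ?mulr0.
have := gen t [::]; rewrite (bigD1 x) //= [X in _ + X]big1 ?addr0 => [|y yx].
  by rewrite big_nil mul1r => /eqP; rewrite mulf_eq0 (negPf tx) orbF => /eqP.
by rewrite ty ?mem_enum // !mulr0.
Qed.

Variables (w : X -> J -> F).

(** A word in [J] expands into words in [I] of the same length. Vanishing is arranged along the
    algebraic derivations [I], while the analytic estimate works along the real coordinates [J]. *)
Lemma words_vanish (Y : J -> I -> F) k :
  (forall x j, w x j = \sum_i Y j i * u x i) ->
  (forall s : seq I, (size s < k)%N -> \sum_x q x * \prod_(i <- s) u x i = 0) ->
  forall (r : seq J), (size r < k)%N -> \sum_x q x * \prod_(j <- r) w x j = 0.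
Proof.
move=> wE q0.
have gen r s : (size r + size s < k)%N ->
    \sum_x q x * (\prod_(j <- r) w x j * \prod_(i <- s) u x i) = 0.
  elim: r s => [|j r IH] s h.
    by rewrite -[RHS](q0 s) //; apply: eq_bigr => y _; rewrite big_nil mul1r.
  transitivity (\sum_i Y j i * \sum_x q x * (\prod_(j <- r) w x j * \prod_(i <- i :: s) u x i)).
    under [RHS]eq_bigr do rewrite mulr_sumr; rewrite exchange_big /=.
    apply: eq_bigr => x _; rewrite big_cons wE !mulr_suml mulr_sumr.
    by apply: eq_bigr => i _; rewrite big_cons; ring.
  by rewrite big1 // => i _; rewrite IH ?mulr0 //= addnS.
move=> r rk; rewrite -[RHS](gen r [::]) ?addn0 //.
by apply: eq_bigr => x _; rewrite big_nil mulr1.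
Qed.

End Words.

(** The way back from [J] to [I]: each letter expands into [#|J|] letters with coefficients of
    modulus at most [c]. *)
Lemma words_bound (F : numFieldType) (X I J : finType) (q : X -> F)
    (u : X -> I -> F) (w : X -> J -> F) (Z : I -> J -> F) (c : nat) (b : F) k :
  (forall x i, u x i = \sum_j Z i j * w x j) -> (forall i j, `|Z i j| <= c%:R) ->
  (forall r : seq J, size r = k -> `|\sum_x q x * \prod_(j <- r) w x j| <= b) ->
  forall s : seq I, size s = k ->
    `|\sum_x q x * \prod_(i <- s) u x i| <= ((#|J| * c) ^ k)%:R * b.
Proof.
move=> uE Zc qb.
have gen s r : (size r + size s = k)%N ->
    `|\sum_x q x * (\prod_(j <- r) w x j * \prod_(i <- s) u x i)| <= ((#|J| * c) ^ size s)%:R * b.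
  elim: s r => [|i s IH] r h.
    rewrite expn0 mul1r; apply: le_trans (qb r _); last by rewrite -h addn0.
    by rewrite le_eqVlt; apply/orP; left; apply/eqP; congr `|_|; apply: eq_bigr => x _; rewrite big_nil mulr1.
  have -> : \sum_x q x * (\prod_(j <- r) w x j * \prod_(i <- i :: s) u x i)
     = \sum_j Z i j * \sum_x q x * (\prod_(j <- j :: r) w x j * \prod_(i <- s) u x i).
    under [RHS]eq_bigr do rewrite mulr_sumr; rewrite exchange_big /=.
    apply: eq_bigr => x _; rewrite big_cons uE !mulr_suml !mulr_sumr.
    by apply: eq_bigr => j _; rewrite big_cons; ring.
  apply: le_trans (ler_norm_sum _ _ _) _.
  apply: (@le_trans _ _ (\sum_(j : J) c%:R * (((#|J| * c) ^ size s)%:R * b))).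
    apply: ler_sum => j _; rewrite normrM ler_pM //; apply: IH.
    by rewrite -h /= addnS.
  by rewrite sumr_const -[_ *+ _]mulr_natl expnS !natrM !mulrA lexx.
move=> s sk; have := gen s [::] sk; rewrite sk; apply: le_trans.
by rewrite le_eqVlt; apply/orP; left; apply/eqP; congr `|_|; apply: eq_bigr => x _; rewrite big_nil mul1r.
Qed.

Lemma prod_word_filter (F : comNzRingType) (J : eqType) (f : J -> F) (h : J) (s : seq J) :
  \prod_(j <- s) f j = f h ^+ count_mem h s * \prod_(j <- [seq j <- s | j != h]) f j.
Proof.
elim: s => [|j s IH] /=; first by rewrite !big_nil mulr1.
rewrite big_cons IH; case: eqP => [->|_] /=; first by rewrite exprS mulrA.
by rewrite big_cons mulrCA.
Qed.

Lemma word_pigeonhole (J : finType) (s : seq J) :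
  (0 < size s)%N -> exists j, (size s <= #|J| * count_mem j s)%N.
Proof.
move=> s0; apply/existsP; rewrite -[X in is_true X]negbK negb_exists; apply/forallP => lt.
have szE : size s = (\sum_j count_mem j s)%N.
  elim: s {s0 lt} => [|i s IH] /=; first by rewrite big1.
  rewrite big_split /= -IH (bigD1 i) //= eqxx big1 // => j /negPf.
  by rewrite eq_sym => ->.
have : (\sum_j #|J| * count_mem j s <= \sum_(j : J) (size s).-1)%N.
  by apply: leq_sum => j _; have := lt j; lia.
rewrite -big_distrr -szE sum_nat_const /= leq_mul2l => /orP[/eqP J0|]; last by lia.
by case: s s0 {lt szE} => // i _ _; have := fintype0 i J0.
Qed.

(** * Exponential polynomials at integer points *)

Section ExpWords.
Variables (R : realType) (X J : finType) (p : X -> int) (w : X -> J -> R).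

(** Up to a power of the imaginary unit, this is the derivative along the word [r], at the point
    [s], of the exponential polynomial with coefficients [p] and frequencies [w]. *)
Definition exp_word (r : seq J) (s : J -> nat) : R[i] :=
  \sum_x (p x)%:~R * \prod_h expi (w x h * (s h)%:R) * \prod_(j <- r) (w x j)%:C%C.

(* Some letter [h] occurs [m >= k / #|J|] times in the word; apply the one-variable
   estimate to the coordinate [h]. *)
Lemma exp_word_bound (P W S k : nat) :
  (0 < k)%N -> (forall x, `|p x| <= P)%N -> (forall x j, `|w x j| <= W%:R) ->
  (forall r s, (size r < k)%N -> (forall j, s j < S)%N -> exp_word r s = 0) ->
  forall r s, size r = k -> (forall j, s j < S)%N ->
    exists m, [/\ (0 < m)%N, (m <= k)%N, (k <= #|J| * m)%N &
      `|exp_word r s| * (m * S)`!%:R <=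
        (#|X| * (P * W ^ (k - m)) * W ^ (m * S) * (m`! * S ^ (m * S)))%:R].
Proof.
move=> k0 pP wW zero r s rk sS.
have [|h hr] := @word_pigeonhole _ r; first by rewrite rk.
rewrite rk in hr; exists (count_mem h r).
have m0 : (0 < count_mem h r)%N by case: (count_mem h r) hr => // ; lia.
have mk : (count_mem h r <= k)%N by rewrite -rk count_size.
split=> //; set m := count_mem h r in hr m0 mk *.
pose r' := [seq j <- r | j != h].
have sz_r' : size r' = (k - m)%N.
  by rewrite size_filter -rk -(count_predC (pred1 h) r) addKn.
pose q x := (p x)%:~R * \prod_(j | j != h) expi (w x j * (s j)%:R) *
  \prod_(j <- r') (w x j)%:C%C.
have -> : exp_word r s = \sum_x q x * (w x h)%:C%C ^+ m * expi (w x h * (s h)%:R).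
  apply: eq_bigr => x _; rewrite [\prod_(j <- r) _](prod_word_filter _ h) (bigD1 h) //= /q; ring.
apply: exp_sum_schwarz => //.
  apply: (@le_trans _ _ (\sum_(x : X) (P * W ^ (k - m))%:R)).
    apply: ler_sum => x _; rewrite !normrM normr_prod natrM.
    rewrite [X in _ * X * _]big1 ?mulr1 => [|j _]; last exact: expi_norm.
    apply: ler_pM => //; first by rewrite -intr_norm -abszE ler_nat.
    rewrite -sz_r' natrX normr_prod; elim: r' {sz_r' q} => [|j t IH].
      by rewrite big_nil.
    rewrite big_cons exprS ler_pM ?prodr_ge0 //.
    by rewrite normc_real -(rmorph_nat (real_complex R)) lecR.
  by rewrite sumr_const -[_ *+ _]mulr_natl -natrM.
move=> j l jS lm.
(* Only the coordinate [h] moves. The word made of [l < m] letters [h] and of [r'] is shorter than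
   [k], so [zero] applies to it. *)
pose s' i := if i == h then j else s i.
rewrite -[RHS](zero (nseq l h ++ r') s'); first last.
- by move=> i; rewrite /s'; case: eqP.
- by rewrite size_cat size_nseq sz_r'; lia.
apply: eq_bigr => x _; rewrite big_cat /= [\prod_(i <- nseq l h) _]big_nseq.
rewrite (bigD1 h) //= /s' eqxx /q -/r'.
have -> : \prod_(i | i != h) expi (w x i * (if i == h then j else s i)%:R)
   = \prod_(i | i != h) expi (w x i * (s i)%:R).
  by apply: eq_bigr => i /negPf->.
by rewrite iter_mulr_1; ring.
Qed.

End ExpWords.

(** * The transcendence argument *)

Lemma norm_bound_family (R : realType) (I J : finType) (f : I -> J -> R[i]) :
  exists c : nat, forall i j, `|f i j| <= c%:R.
Proof.
have /choice [c cP] (x : I * J) : exists c : nat, `|f x.1 x.2| <= c%:R.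
  exists (Num.bound (complex.Re `|f x.1 x.2|)).
  rewrite normc_def -(rmorph_nat (real_complex R)) lecR /=.
  by apply/ltW/archi_boundP; rewrite sqrtr_ge0.
exists (\max_x c x)%N => i j; apply: le_trans (cP (i, j)) _.
by rewrite ler_nat; apply: leq_bigmax.
Qed.

(* The coordinates of the row space of [A] are the [u l], on which the [I]-indexed
   derivations act by algebraic numbers; [Y] and [Z] pass to and from the
   derivations along the coordinates [J] of the points. *)
Theorem exp_matrix_kernel (R : realType) (G I J : finType) (A : J -> G -> R)
    (U : I -> G -> R[i]) (Y : J -> I -> R[i]) (Z : I -> J -> R[i]) (delta : nat) :
  (#|I| < #|G|)%N ->
  (forall j g, (A j g)%:C%C = \sum_i Y j i * U i g) ->
  (forall i g, U i g = \sum_j Z i j * (A j g)%:C%C) ->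
  (forall i g, integralOver (intr : int -> R[i]) (U i g)) ->
  (0 < delta)%N ->
  (forall j g, integralOver (intr : int -> R[i]) (delta%:R * expi (A j g))) ->
  exists l : G -> int, (exists g, l g != 0) /\ forall j, \sum_g (l g)%:~R * A j g = 0.
Proof.
move=> IG AE UE Uint delta0 Eint; apply: contrapT => nex.
have ker (l : G -> int) : (forall j, \sum_g (l g)%:~R * A j g = 0) -> forall g, l g = 0.
  move=> l0 g; apply/eqP; apply: contra_notT nex => lg.
  by exists l; split=> //; exists g.
have [|Jm [v [j0 [H1 [vj0 rep1]]]]] := @int_rep_exists R[i]
   ([seq U x.1 x.2 | x : I * G] ++ [seq delta%:R * expi (A x.1 x.2) | x : J * G]).
  by move=> z; rewrite mem_cat => /orP[] /mapP[x _ ->].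
pose H := (H1 + delta + 1)%N; have H0 : (0 < H)%N by rewrite /H addn1.
have repU i g : int_rep v H (U i g).
  apply: (@int_rep_le _ _ _ H1); first by rewrite /H; lia.
  by apply: rep1; rewrite mem_cat; apply/orP; left; apply/mapP; exists (i, g); rewrite ?mem_enum.
have repE j g : int_rep v H (delta%:R * expi (A j g)).
  apply: (@int_rep_le _ _ _ H1); first by rewrite /H; lia.
  by apply: rep1; rewrite mem_cat; apply/orP; right; apply/mapP; exists (j, g); rewrite ?mem_enum.
have [c cP] := norm_bound_family Z.
have [cA cAP] := norm_bound_family (fun j g => (A j g)%:C%C).
have K0 : (0 < #|Jm|)%N by apply/card_gt0P; exists j0.
have [C [S [T [L [X [[T0 L0 S0 CM X0] [siegel_card param]]]]]]] :=
  parameters #|J| H delta c cA IG K0.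
cbv zeta in param; set W := (#|G| * cA * L)%N in param; set D := (#|J| * #|G| * L * S.+1)%N in param.
set P := (L ^ #|G| * (_ ^ (#|I| * T) * _))%N in param.
(* [Lam] indexes the monomials of degree below [L] in each exponential; [w l j] is the frequency of
   the monomial [l] along [j], and [u l i] its multiplier under the derivation [i]. *)
pose Lam := {ffun G -> 'I_L}.
have cardLam : #|{: Lam}| = (L ^ #|G|)%N by rewrite card_ffun card_ord.
pose u (l : Lam) i := \sum_g (l g)%:R * U i g.
pose w (l : Lam) j := \sum_g (l g)%:R * A j g.
have wE l j : (w l j)%:C%C = \sum_g (l g)%:R * (A j g)%:C%C.
  by rewrite rmorph_sum; apply: eq_bigr => g _; rewrite rmorphM rmorph_nat.
have wu l j : (w l j)%:C%C = \sum_i Y j i * u l i.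
  under [RHS]eq_bigr do rewrite mulr_sumr; rewrite exchange_big wE.
  apply: eq_bigr => g _; rewrite AE mulr_sumr; apply: eq_bigr => i _.
  by rewrite mulrCA.
have uw l i : u l i = \sum_j Z i j * (w l j)%:C%C.
  under [RHS]eq_bigr do rewrite wE mulr_sumr; rewrite exchange_big.
  apply: eq_bigr => g _; rewrite UE mulr_sumr; apply: eq_bigr => j _.
  by rewrite mulrCA.
(* Two monomials with equal multipliers would give an integer relation between the columns of [A],
   against [ker]. *)
have u_sep x y : x != y -> exists i, u x i != u y i.
  move=> xy; apply: contrapT => eq_u; move/eqP: xy; apply; apply/ffunP => g.
  have {}eq_u i : u x i = u y i by apply/eqP; apply: contra_notT eq_u => ui; exists i.
  have eq_w j : w x j = w y j.
    by apply: complexI; rewrite !wu; apply: eq_bigr => i _; rewrite eq_u.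
  have := ker (fun g => (x g)%:Z - (y g)%:Z); move/(_ _ g)/eqP.
  rewrite subr_eq0 => h; apply/val_inj/eqP; apply: h => j.
  rewrite -[RHS](subrr (w y j)) -{1}(eq_w j) /w -sumrB; apply: eq_bigr => i _.
  by rewrite rmorphB mulrBl.
have w_le l j : `|w l j| <= W%:R.
  apply: le_trans (ler_norm_sum _ _ _) _.
  apply: (@le_trans _ _ (\sum_(g : G) (cA * L)%:R)).
    apply: ler_sum => g _; rewrite normrM normr_nat mulrC natrM ler_pM //.
      have := cAP j g; rewrite normc_real.
      by rewrite -(rmorph_nat (real_complex R)) lecR.
    by rewrite ler_nat ltnW.
  by rewrite sumr_const -[_ *+ _]mulr_natl -natrM mulnA.
(* When the coordinates of [s] are at most [S], this is [delta ^ D] times the value of the monomial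
   [l] at [s], the powers of [delta] being distributed so that every factor is integral. *)
pose phi (l : Lam) (s : J -> nat) : R[i] := \prod_j \prod_g
  (delta%:R ^+ (L * S.+1 - l g * s j) * (delta%:R * expi (A j g)) ^+ (l g * s j)).
have ls_le (l : Lam) (s : J -> nat) j g : (s j < S.+1)%N -> (l g * s j <= L * S.+1)%N.
  by move=> sj; rewrite leq_mul // ltnW.
have phiE l (s : J -> nat) : (forall j, (s j < S.+1)%N) ->
    phi l s = (delta ^ D)%:R * \prod_j expi (w l j * (s j)%:R).
  move=> sS; rewrite /phi.
  have -> : (delta ^ D)%:R = \prod_(j : J) \prod_(g : G) (delta ^ (L * S.+1))%:R :> R[i].
    by rewrite !prodr_const -!natrX -!expnM; congr (_ ^ _)%:R; rewrite /D; ring.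
  rewrite -big_split; apply: eq_bigr => j _ /=.
  rewrite /w mulr_suml expi_sum -big_split; apply: eq_bigr => g _ /=.
  rewrite exprMn mulrA -exprD subnK ?ls_le // natrX; congr (_ * _).
  by rewrite -expiMn; congr expi; rewrite -[LHS]mulr_natl natrM; ring.
have repphi l (s : J -> nat) : (forall j, (s j < S.+1)%N) -> int_rep v (H ^ D) (phi l s).
  move=> sS; have -> : (H ^ D = \prod_(j : J) \prod_(g : G) H ^ (L * S.+1))%N.
    by rewrite !prod_nat_const -!expnM; congr (_ ^ _)%N; rewrite /D; ring.
  apply: int_rep_prod => j _; apply: int_rep_prod => g _.
  rewrite -[X in (_ ^ X)%N](subnK (ls_le l s j g (sS j))) expnD.
  apply: int_repM; last exact: int_repX.
  apply: int_repX; apply: int_rep_le (int_rep_int _ delta).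
  by rewrite /H; lia.
have repu l i : int_rep v (#|G| * L * H) (u l i).
  have -> : (#|G| * L * H = \sum_(g : G) L * H)%N by rewrite sum_nat_const mulnA.
  apply: int_rep_sum => g _; apply: int_repM => //.
  by apply: int_rep_le (int_rep_int v (l g)); exact: (ltnW (ltn_ord _)).
pose B0 := ((#|G| * L * H) ^ (#|I| * T) * H ^ D)%N.
have NLH0 : (0 < #|G| * L * H)%N.
  by rewrite !muln_gt0 L0 H0 (leq_ltn_trans _ IG).
have B00 : (0 < B0)%N by rewrite muln_gt0 !expn_gt0 NLH0 H0.
have /choice [B BP] (x : {ffun I -> 'I_T} * {ffun J -> 'I_S.+1} * Lam) : exists B : Jm -> Jm -> int,
    (forall j, (\prod_i u x.2 i ^+ x.1.1 i * phi x.2 (fun j => x.1.2 j)) * v j = \sum_k (B j k)%:~R * v k) /\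
    (forall j, (\sum_k `|B j k| <= B0)%N).
  case: x => [[e s] l] /=; apply: int_repM; last by apply: repphi.
  apply: int_rep_le (int_rep_prod _ (fun i _ => int_repX (e i) (repu l i))).
  rewrite -expn_sum leq_pexp2l // -sum_nat_const.
  by apply: leq_sum => i _; exact: ltnW.
(* The equations range over the exponent vectors below [T], the points and the components of [v].
   The row [j0] suffices: as [v j0 = 1], it writes each value as a combination of the [v k] whose
   integer coefficients are the linear forms to be killed. *)
have [|||p [p0 pP peq]] := @siegel Lam (({ffun I -> 'I_T} * {ffun J -> 'I_S.+1}) * Jm)%type
   (fun e l => B (e.1, l) j0 e.2) B0 B00.
- by rewrite cardLam expn_gt0 L0.
- by rewrite cardLam !card_prod !card_ffun !card_ord.
- move=> e l; have [_ /(_ j0)] := BP (e.1, l); apply: leq_trans.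
  by rewrite (bigD1 e.2) //= leq_addr.
rewrite cardLam -/P in pP.
pose Eu r s := \sum_l (p l)%:~R * \prod_j expi (w l j * (s j)%:R) * \prod_(i <- r) u l i.
have gammaE r (s : J -> nat) : (forall j, (s j < S.+1)%N) ->
    \sum_l (p l)%:~R * (\prod_(i <- r) u l i * phi l s) = (delta ^ D)%:R * Eu r s.
  move=> sS; rewrite mulr_sumr; apply: eq_bigr => l _; rewrite phiE //; ring.
have deltaD0 : (delta ^ D)%:R != 0 :> R[i] by rewrite pnatr_eq0 -lt0n expn_gt0 delta0.
have vanT r s : (size r < T)%N -> (forall j, (s j < S.+1)%N) -> Eu r s = 0.
  move=> rT sS; apply: (mulfI deltaD0); rewrite mulr0 -gammaE //.
  have eT i : (count_mem i r < T)%N by apply: leq_ltn_trans rT; apply: count_size.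
  pose e := [ffun i => Ordinal (eT i)]; pose s' := [ffun j => Ordinal (sS j)].
  transitivity (\sum_k (\sum_l B (e, s', l) j0 k * p l)%:~R * v k); last first.
    by rewrite big1 // => k _; rewrite (peq (e, s', k)) mul0r.
  under [RHS]eq_bigr do rewrite rmorph_sum mulr_suml; rewrite exchange_big /=.
  apply: eq_bigr => l _; have [/(_ j0) + _] := BP (e, s', l).
  rewrite vj0 mulr1 /= prod_word => h.
  under [RHS]eq_bigr do rewrite rmorphM mulrAC mulrC; rewrite -mulr_sumr -h.
  congr (_ * (_ * _)).
    by apply: eq_bigr => i _; rewrite ffunE.
  by congr phi; apply/funext => j; rewrite ffunE.
have [r1 [s1 [s1S nz]]] : exists r s, (forall j, (s j < S.+1)%N) /\ Eu r s != 0.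
  apply: contrapT => all0; have [l] := p0; apply/negP; rewrite negbK.
  rewrite -(intr_eq0 R[i]); apply/eqP; apply: (words_separate (q := fun l => (p l)%:~R) u_sep) => r.
  apply: contrapT => /eqP ne; apply: all0; exists r, (fun=> 0%N); split=> //.
  apply: contra ne => /eqP h; apply/eqP; apply: etrans h; apply: eq_bigr => x _.
  by rewrite [X in _ = _ * X * _]big1 ?mulr1 // => j _; rewrite mulr0 expi0.
have exk : exists k, `[< exists r s, [/\ size r = k, forall j, (s j < S.+1)%N & Eu r s != 0] >].
  by exists (size r1); apply/asboolP; exists r1, s1.
case: (ex_minnP exk) => k /asboolP [r [s [rk sS Ers]]] kmin.
have zero r' s' : (size r' < k)%N -> (forall j, (s' j < S.+1)%N) -> Eu r' s' = 0.
  move=> r'k s'S; apply: contraTeq r'k => ne; rewrite -leqNgt; apply: kmin.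
  by apply/asboolP; exists r', s'.
have Tk : (T <= k)%N by rewrite leqNgt; apply: contra Ers => kT; rewrite vanT ?rk.
have [Wk fin] := param k Tk; have k0 : (0 < k)%N by apply: leq_trans Tk.
have XC0 : 0 < (X ^ (C * k))%:R :> R[i] by rewrite ltr0n expn_gt0 X0.
(* All shorter words vanish at all the points, by minimality of [k], so the Schwarz estimate applies
   at order [k]. *)
have bound (r' : seq J) : size r' = k ->
    `|\sum_l (p l)%:~R * \prod_j expi (w l j * (s j)%:R) * \prod_(j <- r') (w l j)%:C%C|
      <= (L ^ #|G| * P * W ^ k)%:R / (X ^ (C * k))%:R.
  move=> r'k; have [||m [m0 mk km]] := @exp_word_bound R Lam J p w P W S.+1 k k0 _ w_le _ r' s r'k sS.
  - exact: pP.
  - move=> r'' s'' ? s''S; apply: (words_vanish (k := k)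
      (q := fun l => (p l)%:~R * \prod_j expi (w l j * (s'' j)%:R)) wu) => // t tk.
    exact: zero.
  rewrite cardLam ler_pdivlMr // => h.
  have F0 : 0 < (m * S.+1)`!%:R :> R[i] by rewrite ltr0n fact_gt0.
  rewrite -(ler_pM2r F0) mulrAC; apply: le_trans (ler_wpM2r (ltW XC0) h) _.
  by rewrite -!natrM ler_nat; apply: (extrapolation_gain _ _ X0 S0 CM mk km Wk m0).
have := words_bound uw cP bound rk => Ebound.
(* [Hg] is the size of the integral number [delta ^ D * Eu r s]. Liouville's lower bound for it and
   the upper bound [Ebound] contradict [fin]. *)
pose Hg := (L ^ #|G| * P * (#|G| * L * H) ^ k * H ^ D)%N.
have repg : int_rep v Hg ((delta ^ D)%:R * Eu r s).
  rewrite -gammaE //; have -> : Hg = (\sum_(l : Lam) P * ((#|G| * L * H) ^ k * H ^ D))%N.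
    by rewrite sum_nat_const cardLam /Hg; ring.
  apply: int_rep_sum => l _; apply: int_repM.
    by apply: int_rep_le (int_rep_int _ (p l)).
  apply: int_repM; last exact: repphi.
  have -> : ((#|G| * L * H) ^ k = \prod_(i <- r) (#|G| * L * H))%N.
    by rewrite big_const_seq count_predT iter_muln_1 rk.
  exact: int_rep_prod.
have Hg0 : (0 < Hg)%N.
  by rewrite !muln_gt0 !expn_gt0 NLH0 H0 L0.
have := int_rep_liouville (j0 := j0) _ Hg0 repg _.
rewrite vj0 oner_neq0 => /(_ isT); rewrite mulf_neq0 // => /(_ isT).
rewrite normrM normr_nat => lio.
move: Ebound lio fin; rewrite -/Hg; clearbody Hg.
move: (L ^ _ * _ * _)%N ((_ * c) ^ k)%N (delta ^ D)%N => a1 a2 a3 Ebound lio.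
rewrite ltnNge -(ler_nat R[i]) => /negP; apply.
rewrite -[leLHS]mul1r -ler_pdivlMr //; apply: le_trans lio _.
rewrite !natrM natrX [leRHS]mulrAC ler_wpM2r ?exprn_ge0 // -!mulrA ler_wpM2l //.
Qed.

(** * Characters of a finite abelian group *)

(** [A] is killed by X^N - 1, which is separable in characteristic zero. *)
Lemma unity_mx_diagonalizable (F : numClosedFieldType) (n N : nat) (A : 'M[F]_n) :
  (0 < N)%N -> iter N (mulmx A) 1%:M = 1%:M -> diagonalizable A.
Proof.
case: n A => [|n] A N0 AN.
  by exists 1%:M; [rewrite unitmx1 | apply/is_diag_mxP => -[]].
have {}AN : A ^+ N = 1.
  by rewrite -[1]/(1%:M) -[RHS]AN; elim: N {N0 AN} => [//|k IH] /=; rewrite exprS IH.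
have [rs rsE] := closed_field_poly_normal ('X^N - 1%:P : {poly F}).
rewrite (monicP (monicXnsubC _ N0)) scale1r in rsE.
apply/diagonalizableP; exists rs.
  by rewrite -separable_prod_XsubC -rsE separable_Xn_sub_1 // pnatr_eq0 -lt0n.
by rewrite -rsE; apply: mxminpoly_min; rewrite rmorphB rmorphXn /= horner_mx_X horner_mx_C AN subrr.
Qed.

(* The [d i] are the eigenvalue functions of the regular representation, which is
   simultaneously diagonalizable. *)
Theorem character_table (F : numClosedFieldType) (gT : finGroupType) :
  abelian [set: gT] -> exists (d : 'I_#|gT| -> gT -> F) (e : gT -> 'I_#|gT| -> F),
    [/\ forall i x y, d i (x * y)%g = d i x * d i y,
        forall i x, d i x ^+ #|gT| = 1
      & forall x y, \sum_i e x i * d i y = (x == y)%:R].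
Proof.
move=> abG; have N0 : (0 < #|gT|)%N by apply/card_gt0P; exists 1%g.
pose P (h : gT) : 'M[F]_#|gT| := \matrix_(i, j) ((enum_val i * h)%g == enum_val j)%:R.
have PE (m : nat) (q : 'M[F]_(m, #|gT|)) h i y :
    (q *m P h) i (enum_rank y) = q i (enum_rank (y * h^-1)%g).
  rewrite mxE (bigD1 (enum_rank (y * h^-1)%g)) //= big1 ?addr0.
    by rewrite mxE !enum_rankK mulgKV eqxx mulr1.
  move=> j jy; rewrite mxE enum_rankK; case: eqP => [yE|]; last by rewrite mulr0.
  by case/negP: jy; rewrite -yE mulgK enum_valK.
have mxP (m : nat) (q1 q2 : 'M[F]_(m, #|gT|)) :
    (forall i y, q1 i (enum_rank y) = q2 i (enum_rank y)) -> q1 = q2.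
  by move=> h; apply/matrixP => i j; rewrite -[j]enum_valK.
have PM h h' : P h *m P h' = P (h * h')%g.
  apply: mxP => i y; rewrite PE !mxE !enum_rankK.
  by rewrite -(inj_eq (mulIg h')) mulgKV mulgA.
have P1 : P 1%g = 1%:M.
  by apply: mxP => i y; rewrite !mxE mulg1 enum_rankK (can2_eq enum_valK enum_rankK).
have PX h k : iter k (mulmx (P h)) 1%:M = P (h ^+ k)%g.
  by elim: k => [|k IH] /=; rewrite ?expg0 ?P1 // IH PM expgS.
have xG (x : gT) : (x ^+ #|gT| = 1)%g by rewrite -cardsT; apply: cyclic.expg_cardG; rewrite inE.
have [Q Qu /allP QP] : codiagonalizable [seq P h | h : gT].
  apply/codiagonalizableP; split=> [A B /mapP[h _ ->] /mapP[h' _ ->]|A /mapP[h _ ->]].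
    rewrite /comm_mx !PM; congr P; have /centsP := abG.
    by move=> /(_ h (finset.in_setT _) h' (finset.in_setT _)).
  by apply: (unity_mx_diagonalizable N0); rewrite PX xG P1.
have Qeig h : exists D : 'I_#|gT| -> F, forall i y,
    Q i (enum_rank (y * h^-1)%g) = D i * Q i (enum_rank y).
  have /QP/= : P h \in [seq P h | h : gT] by apply: map_f; rewrite mem_enum.
  case/diagonalizable_forPex => D /(simmxP Qu) QD; exists (D 0) => i y.
  by rewrite -PE QD mul_diag_mx mxE.
have Q1 i : Q i (enum_rank 1%g) != 0.
  apply/negP => /eqP q0; have : row i Q = 0.
    apply/mxP => k y; rewrite !mxE; have [D /(_ i 1%g)] := Qeig y^-1%g.
    by rewrite invgK mul1g q0 mulr0.
  move=> /(congr1 (mulmx^~ (invmx Q))); rewrite -row_mul mulmxV // mul0mx.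
  by move=> /rowP/(_ i)/eqP; rewrite !mxE eqxx oner_eq0.
(* The rows of [Q] are common eigenvectors of the translations; divided by its value at 1, such a
   row is multiplicative. [e] is the inverse of [Q], rescaled to match. *)
pose d i x := Q i (enum_rank x) / Q i (enum_rank 1%g).
pose e x i := invmx Q (enum_rank x) i * Q i (enum_rank 1%g).
have dM i x y : d i (x * y)%g = d i x * d i y.
  have [D h] := Qeig y^-1%g; have := h i x; have := h i 1%g; rewrite invgK mul1g /d.
  by move=> -> ->; rewrite [X in _ = _ * X]mulfK ?Q1 // [RHS]mulrC mulrA.
have d1 i : d i 1%g = 1 by rewrite /d divff.
exists d, e; split=> // [i x|x y].
  rewrite -[RHS](d1 i) -(xG x); elim: #|gT| => [|k IH]; first by rewrite d1.
  by rewrite exprS IH expgS dM.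
transitivity ((invmx Q *m Q) (enum_rank x) (enum_rank y)).
  by rewrite mxE; apply: eq_bigr => i _; rewrite /e /d mulrA [X in X / _]mulrAC mulfK.
by rewrite mulVmx // mxE (inj_eq enum_rank_inj).
Qed.

(** * Denominators of algebraic numbers *)

(** If p has degree n and leading coefficient b, then b^(n-1) p(z) is a monic integer polynomial in
    b z. *)
Lemma algebraic_denominator (F : numFieldType) (z : F) :
  algebraicOver (ratr : rat -> F) z ->
  exists2 delta : nat, (0 < delta)%N & integralOver (intr : int -> F) (delta%:R * z).
Proof.
case=> q q0 qz; have [p [a a0 qE]] := rat_poly_scale q.
have pz : root (map_poly intr p) z.
  move: qz; rewrite qE /root map_polyZ hornerZ mulf_eq0 fmorph_eq0 invr_eq0 intr_eq0 (negPf a0) /=.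
  rewrite -map_poly_comp; congr (_.[_] == _).
  by apply: eq_map_poly => i /=; rewrite ratr_int.
have p0 : p != 0 by apply: contra q0 => /eqP p0; rewrite qE p0 map_poly0 scaler0.
have p1 : (1 < size p)%N.
  rewrite ltnNge; apply/negP => /size1_polyC pE; move: pz p0.
  by rewrite pE map_polyC rootC /= intr_eq0 polyC_eq0 => ->.
pose n := (size p).-1; pose b := lead_coef p.
have szp : size p = n.+1 by rewrite /n prednK // ltnW.
have n0 : (0 < n)%N by rewrite -ltnS -szp.
have bz : integralOver (intr : int -> F) (b%:~R * z).
  exists ('X^n + \poly_(i < n) (p`_i * b ^+ (n.-1 - i))).
    by rewrite monicE lead_coefDl ?lead_coefXn // size_polyXn ltnS size_poly.
  rewrite /root rmorphD /= map_polyXn hornerD hornerXn.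
  have -> : map_poly (intr : int -> F) (\poly_(i < n) (p`_i * b ^+ (n.-1 - i)))
     = \poly_(i < n) ((p`_i)%:~R * b%:~R ^+ (n.-1 - i)).
    apply/polyP => i; rewrite coef_map !coef_poly; case: ifP => _ //=.
    by rewrite rmorphM rmorphXn.
  rewrite horner_poly; move: pz; rewrite /root => /eqP pz; apply/eqP.
  transitivity (b%:~R ^+ n.-1 * (map_poly intr p).[z]); last by rewrite pz mulr0.
  rewrite horner_coef size_map_inj_poly ?rmorph0 //; last exact: intr_inj.
  rewrite szp big_ord_recr /= mulrDr addrC mulr_sumr; congr (_ + _).
    apply: eq_bigr => i _; rewrite coef_map exprMn /=.
    have -> : b%:~R ^+ n.-1 = b%:~R ^+ (n.-1 - i) * b%:~R ^+ i :> F.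
      by rewrite -exprD subnK //; have := ltn_ord i; lia.
    by ring.
  rewrite coef_map /= exprMn mulrA -lead_coefE -/b.
  by rewrite -[X in _ ^+ X](prednK n0) exprSr.
exists `|b|%N; first by rewrite absz_gt0 lead_coef_eq0.
have [b0|b0] := leP 0 b.
  by have -> : `|b|%N%:R = b%:~R :> F by rewrite -[in RHS](gez0_abs b0).
have -> : `|b|%N%:R = - b%:~R :> F by rewrite -rmorphN -ltz0_abs.
rewrite mulNr; exact: integral_opp.
Qed.

Lemma common_denominator (F : numFieldType) (I : finType) (z : I -> F) :
  (forall i, algebraicOver (ratr : rat -> F) (z i)) ->
  exists2 delta : nat, (0 < delta)%N &
    forall i, integralOver (intr : int -> F) (delta%:R * z i).
Proof.
move=> /(_ _)/algebraic_denominator alg.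
have /choice [f fP] i : exists n : nat, (0 < n)%N /\ integralOver (intr : int -> F) (n%:R * z i).
  by have [n ? ?] := alg i; exists n.
exists (\prod_i f i)%N; first by apply/prodn_gt0 => i; have [] := fP i.
move=> i; rewrite (bigD1 i) //= mulnC natrM -mulrA; apply: integral_mul.
  exact: integral_nat.
by have [] := fP i.
Qed.

Lemma algebraic_number (k : fieldExtType rat) (F : numFieldType) (f : {rmorphism k -> F}) x :
  algebraicOver (ratr : rat -> F) (f x).
Proof.
have /polyOver1P [q qE] := minPolyOver 1%AS x.
exists q.
  have := monic_neq0 (monic_minPoly 1%AS x).
  by rewrite qE map_poly_eq0.
have := root_minPoly 1%AS x; rewrite qE /root -(fmorph_eq0 f) -horner_map -map_poly_comp.
congr (_.[_] == _); apply: eq_map_poly => r /=.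
exact: (fmorph_eq_rat (f \o in_alg k)).
Qed.

(** * Nonsingularity of the group matrix *)

(** Characters bring the matrix a(hg) to diagonal form with entries [b i]. If one of these vanishes,
    the matrix factors through fewer than [#|gT|] characters, whose values are roots of unity, and
    [exp_matrix_kernel] yields a forbidden relation. Otherwise the matrix is invertible. *)
Theorem group_matrix_log_injective (R : realType) (gT : finGroupType) (a : gT -> R) :
  abelian [set: gT] ->
  (forall g, algebraicOver (ratr : rat -> R[i]) (expi (a g))) ->
  (forall l : gT -> int, \sum_g (l g)%:~R * a g = 0 -> forall g, l g = 0) ->
  forall c : gT -> R, (forall h, \sum_g c g * a (h * g)%g = 0) -> forall g, c g = 0.
Proof.
move=> abG alg indep c c0.
have [d [e [dM d1X ed]]] := character_table R[i] abG.
have d0 i x : d i x != 0.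
  apply/negP => /eqP dx; have := d1X i x; rewrite dx expr0n gtn_eqF.
    by move/eqP; rewrite eq_sym oner_eq0.
  by apply/card_gt0P; exists 1%g.
have d1 i : d i 1%g = 1.
  by apply: (mulfI (d0 i 1%g)); rewrite mulr1 -dM mulg1.
pose b i := \sum_h d i h * (a h)%:C%C.
have bE i g : \sum_h d i h * (a (h * g)%g)%:C%C = d i g^-1%g * b i.
  rewrite (reindex_inj (mulIg g^-1%g)) /= mulr_sumr; apply: eq_bigr => x _.
  by rewrite mulgKV dM; ring.
have aE h g : (a (h * g)%g)%:C%C = \sum_i e h i * b i * d i g^-1%g.
  transitivity (\sum_x (a x)%:C%C * \sum_i e h i * d i (x * g^-1)%g).
    rewrite (bigD1 (h * g)%g) //= ed mulgK eqxx mulr1 big1 ?addr0 // => x xh.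
    rewrite ed; case: eqP => [hE|]; last by rewrite mulr0.
    by rewrite hE mulgKV eqxx in xh.
  under eq_bigr do rewrite mulr_sumr; rewrite exchange_big /=.
  apply: eq_bigr => i _; rewrite /b mulr_sumr mulr_suml; apply: eq_bigr => x _.
  by rewrite dM; ring.
have [/existsP[i0 bi0]|] := boolP [exists i, b i == 0].
  pose B := [pred i | b i != 0]; pose I := {i in B}.
  have [delta delta0 dint] := common_denominator alg.
  have [|||||l [[g lg] l0]] := @exp_matrix_kernel R gT I gT (fun h g => a (h * g)%g)
    (fun i g => d (val i) g^-1%g) (fun h i => e h (val i) * b (val i))
    (fun i h => d (val i) h / b (val i)) delta _ _ _ _ delta0.
  - rewrite card_sig -[ltnRHS]card_ord; apply: proper_card.
    by apply/properP; split; [exact: subset_predT|exists i0; rewrite ?inE ?bi0].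
  - move=> h g; rewrite aE (bigID (mem B)) /= [X in _ + X]big1 ?addr0.
      exact: big_sub.
    by move=> i; rewrite negbK => /eqP->; rewrite mulr0 mul0r.
  - move=> i g; under eq_bigr do rewrite mulrAC.
    by rewrite -mulr_suml bE mulfK //; exact: (valP i).
  - move=> i g; exists ('X^#|gT| - 1%:P).
      by apply: monicXnsubC; apply/card_gt0P; exists 1%g.
    by rewrite /root rmorphB /= map_polyXn map_polyC /= hornerD hornerN hornerXn hornerC d1X subrr.
  - by move=> h g; apply: dint.
  have /indep/(_ g)/eqP : \sum_g (l g)%:~R * a g = 0.
    by rewrite -[RHS](l0 1%g); apply: eq_bigr => x _; rewrite mul1g.
  by rewrite (negPf lg).
rewrite negb_exists => /forallP b0.
(* As no [b i] vanishes, all Fourier coefficients of [c] do; [e] then inverts the transform. *)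
have dc0 i : \sum_g (c g)%:C%C * d i g^-1%g = 0.
  apply: (mulIf (b0 i)); rewrite mul0r mulr_suml.
  transitivity (\sum_h d i h * (\sum_g c g * a (h * g)%g)%:C%C); last first.
    by rewrite big1 // => h _; rewrite c0 mulr0.
  under [RHS]eq_bigr do rewrite rmorph_sum mulr_sumr; rewrite exchange_big /=.
  apply: eq_bigr => g _; rewrite -mulrA -bE mulr_sumr; apply: eq_bigr => h _.
  by rewrite rmorphM mulrCA.
move=> g; apply: complexI; rewrite rmorph0.
transitivity (\sum_i e g^-1%g i * \sum_x (c x)%:C%C * d i x^-1%g); last first.
  by rewrite big1 // => i _; rewrite dc0 mulr0.
under [RHS]eq_bigr do rewrite mulr_sumr; rewrite exchange_big /=.
transitivity (\sum_x (c x)%:C%C * \sum_i e g^-1%g i * d i x^-1%g).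
  rewrite (bigD1 g) //= ed eqxx mulr1 big1 ?addr0 // => x xg.
  by rewrite ed (inj_eq invg_inj) eq_sym (negPf xg) mulr0.
by apply: eq_bigr => x _; rewrite mulr_sumr; apply: eq_bigr => i _; rewrite mulrCA.
Qed.

(** * Logarithms of the conjugates of [xi] *)

Lemma expiMz (R : realType) (t : R) (m : int) : expi (t * m%:~R) = expi t ^ m.
Proof.
have expiN u : expi (- u) = (expi u)^-1 :> R[i].
  have u0 : expi u != 0 by rewrite -normr_eq0 expi_norm oner_eq0.
  by apply: (mulfI u0); rewrite divff // -expiD subrr expi0.
case: m => n; first by rewrite -exprnP -expiMn -mulr_natr.
by rewrite NegzE -exprz_inv -expiN -exprnP -expiMn -mulr_natr rmorphN mulrN mulNr.
Qed.

Lemma expi_2piq (R : realType) (q : rat) :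
  expi (2 * pi * ratr q : R) ^+ `|denq q| = 1.
Proof.
rewrite -expiMn -[X in expi X]mulr_natr -mulrA.
have -> : (ratr q * `|denq q|%:R : R) = (numq q)%:~R.
  rewrite /ratr [`|_|%:R](_ : _ = (denq q)%:~R) ?divfK ?intr_eq0 ?denq_neq0 //.
  by rewrite -[in RHS](gez0_abs (ltW (denq_gt0 q))).
have pi2 : expi (2 * pi) = 1 :> R[i] by rewrite /expi mulr_natl cos2pi sin2pi.
by rewrite expiMz pi2 exp1rz.
Qed.

Lemma big_subg (T : Type) (idx : T) (op : Monoid.com_law idx) (gT : finGroupType)
    (G : {group gT}) (F : gT -> T) :
  \big[op/idx]_(x in G) F x = \big[op/idx]_(x : subg_of G) F (sgval x).
Proof.
rewrite (reindex_onto (@sgval _ G) (subg G)) => [|x xG]; last exact: subgK.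
by apply: eq_bigl => x; rewrite sgvalK eqxx andbT subgP.
Qed.

Unset Implicit Arguments.
Set Strict Implicit.

Theorem theorem3p7
  (k : fieldExtType rat) (hCM : CM_field k)
  (p : nat) (hp : prime p)
  (iota : {rmorphism k -> CC})                      (* fixed embedding k ⊂ C *)
  (gT : finGroupType) (H : {group gT})
  (act : gT -> {rmorphism k -> k})                   (* H acting on k *)
  (act1 : forall x, act 1%g x = x)
  (actM : forall s t, s \in H -> t \in H -> forall x, act (s * t)%g x = act s (act t x))
  (act_inj : {in H &, forall s t, act s =1 act t -> s = t}) (* H ⊂ Aut k *)
  (habH : abelian H)
  (hc : forall s, s \in H -> ~ (forall x, iota (act s x) = (iota x)^*)) (* c ∉ H *)
  (xi : k) (hxi : E_p p xi)
  (Hxi : {group gT}) (hHxi : Hxi :=: [set s in H | act s xi == xi])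
  (hbasis : basis_EpQ p (H / Hxi)%g (fun t => bar_act act t xi))
  (sv : coset_of Hxi -> gT)                          (* chosen preimages sigma_v *)
  (hsv : forall t, t \in (H / Hxi)%g -> sv t \in H /\ coset Hxi (sv t) = t)
  (s : RR -> RR) (hs : section_mod_2piQ s)
  (* eta t f = theta means the f-coordinate of eta_t in V_k is i*theta *)
  (eta : coset_of Hxi -> {rmorphism k -> CC} -> RR)
  (heta_V : forall t, t \in (H / Hxi)%g ->
     forall f g : {rmorphism k -> CC}, (forall x, g x = (f x)^*) ->
     eta t g = - eta t f)
  (heta_lift : forall t, t \in (H / Hxi)%g -> forall f : {rmorphism k -> CC},
     exists theta : RR, exists q : rat,
       f (bar_act act t xi) = (cos theta +i* sin theta)%C /\
       eta t f = theta + 2 * pi * ratr q)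
  (heta_S : forall t, t \in (H / Hxi)%g -> forall v, v \in (H / Hxi)%g ->
     forall f : {rmorphism k -> CC}, (forall x, f x = iota (act (sv v) x)) ->
     forall theta : RR, f (bar_act act t xi) = (cos theta +i* sin theta)%C ->
       eta t f = s theta) :
  forall c : coset_of Hxi -> RR,
    (forall f : {rmorphism k -> CC}, \sum_(t in (H / Hxi)%g) c t * eta t f = 0) ->
    forall t, t \in (H / Hxi)%g -> c t = 0.
Proof.
move=> c c0 t tG.
have HN : (H \subset 'N(Hxi))%g.
  apply: (sub_abelian_norm habH); apply/fintype.subsetP => x.
  by rewrite hHxi inE => /andP[].
have HxiP y : y \in Hxi -> y \in H /\ act y xi = xi.
  by rewrite hHxi inE => /andP[yH /eqP].
(* The representative is y h with y fixing [xi]; since [H] is abelian, it acts on [xi] as h does. So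
   any preimage may be used. *)
have barE u h : h \in H -> coset Hxi h = u -> repr u \in H /\ bar_act act u xi = act h xi.
  move=> hH hu.
  have /rcosetP[y yHxi ryh] : repr u \in (Hxi :* h)%g.
    apply/rcoset_kercosetP; rewrite ?repr_coset_norm ?(fintype.subsetP HN) //.
    by rewrite coset_reprK.
  have [yH yxi] := HxiP y yHxi.
  rewrite /bar_act ryh groupM //; split=> //.
  by have /centsP := habH; rewrite /commute => -> //; rewrite actM // yxi.
have mem_coset u : u \in (H / Hxi)%g -> exists2 h, h \in H & coset Hxi h = u.
  by case/morphimP => h _ hH ->; exists h.
have barM u v : u \in (H / Hxi)%g -> v \in (H / Hxi)%g ->
    act (sv v) (bar_act act u xi) = bar_act act (v * u)%g xi.
  move=> /mem_coset [h hH hu] vG; have [svH svv] := hsv v vG.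
  have [_ ->] := barE u h hH hu; rewrite -actM //.
  have [||_ ->] // := barE (v * u)%g (sv v * h)%g; first exact: groupM.
  by rewrite coset_morphM ?(fintype.subsetP HN) // svv hu.
have /choice [theta thetaP] u : exists th : RR, u \in (H / Hxi)%g ->
    iota (bar_act act u xi) = expi th.
  have [uG|uG] := boolP (u \in (H / Hxi)%g); last by exists 0.
  by have [th [q [h _]]] := heta_lift u uG iota; exists th.
pose G := (H / Hxi)%G.
(* The section moves an argument by a rational multiple of 2 pi, so [expi (a x)] is a conjugate of
   [xi] times a root of unity. *)
pose a (x : subg_of G) := s (theta (sgval x)).
have aE x : exists q : rat, a x = theta (sgval x) + 2 * pi * ratr q by apply: hs.1.
suff h (x : subg_of G) : c (sgval x) = 0 by rewrite -(@subgK _ G t tG) h.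
move: x; apply: (@group_matrix_log_injective RR (subg_of G) a).
- by have := quotient_abelian Hxi habH; rewrite -(isog_abelian (isog_subg G)).
- move=> x; have [q ->] := aE x; rewrite expiD -thetaP ?subgP //.
  apply: algebraic_mul; first exact: algebraic_number.
  exists ('X^`|denq q| - 1%:P).
    by rewrite monic_neq0 // monicXnsubC // absz_gt0 denq_neq0.
  by rewrite /root rmorphB /= map_polyXn map_polyC /= rmorph1 hornerD hornerN
    hornerXn hornerC expi_2piq subrr.
- move=> l l0 x.
  have [/(_ (fun u => l (subg G u))) + _] := hbasis.
  move=> /(_ _ (sgval x) (subgP x)); rewrite sgvalK; apply.
  have /choice [q qE] := aE.
  (* The power [D] kills these roots of unity, so a linear relation between the [a y] exponentiates
     to a torsion relation between the conjugates of [xi], to which [hbasis] applies. *)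
  pose D := (\prod_y `|denq (q y)|)%N.
  have D0 : (0 < D)%N by apply/prodn_gt0 => y; rewrite absz_gt0 denq_neq0.
  have ED y : expi (a y) ^+ D = iota (bar_act act (sgval y) xi) ^+ D.
    rewrite qE expiD -thetaP ?subgP // exprMn /D (bigD1 y) //= [X in _ * X]exprM.
    by rewrite expi_2piq expr1n mulr1.
  exists D; split=> //; apply: (fmorph_inj iota); rewrite rmorph1 rmorphXn rmorph_prod.
  rewrite (@big_subg _ _ _ _ G) -prodrXl.
  transitivity ((expi (\sum_y (l y)%:~R * a y)) ^+ D); last by rewrite l0 expi0 expr1n.
  rewrite expi_sum -prodrXl; apply: eq_bigr => y _.
  by rewrite sgvalK fmorphXz mulrC expiMz !exprnP !(exprzAC _ (l y)) -!exprnP ED.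
(* The given relation is read at the place of [v], where the embedding is [iota] after
   [act (sv v)]. *)
move=> v; rewrite -[RHS](c0 (iota \o act (sv (sgval v)))) (@big_subg _ _ _ _ G).
apply: eq_bigr => x _; congr (_ * _); symmetry.
apply: (heta_S _ (subgP x) _ (subgP v)) => //=.
by rewrite barM ?subgP // thetaP // groupM ?subgP.
Qed.
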